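(* Let $i\in\{2,4,6,7,8\}$, let $\Phi_i$ be a root system of type $G_2$, $F_4$ (for $i=2,4$) or $E_i$ (for $i=6,7,8$), let $q$ be a power of a prime $p$, and assume $p>3$ for type $G_2$ and $p>2$ for type $F_4$. Let $UY_i=UY_i(q)$ be the corresponding maximal unipotent subgroup. Let $\alpha\in\Phi_i^+$ be a positive root for which there is an arm satisfying both (1) $s(\alpha)$ is a closed pattern, and (2) $\ell(\alpha)\cup k(\alpha)\unlhd s(\alpha)$. Then the arm $a(\alpha)$ satisfying (1) and (2) can be chosen such that the map $$\Psi:\operatorname{Irr}(\overline{T}_\alpha)\times\operatorname{Irr}(X_\alpha)^*\to\operatorname{Irr}(UY_i)_\alpha,\qquad(\mu,\lambda)\mapsto\bigl(\operatorname{Infl}_{\overline{T}_\alpha}^{S_\alpha}\mu\cdot\operatorname{Infl}_{X_\alpha}^{S_\alpha}\lambda\bigr)^{UY_i}$$ is a one to one correspondence (bijection).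
   Context: Let $q$ be a power of a prime $p$, $\Phi$ an irreducible root system of Dynkin type $Y$ and rank $n$ with set of positive roots $\Phi^+$, $Y_n(q)$ the untwisted Chevalley group over $\mathbb{F}_q$ of this type with root subgroups $X_\gamma=\{x_\gamma(t)\mid t\in\mathbb{F}_q\}$, and $UY_n=UY_n(q)=\langle X_\gamma\mid\gamma\in\Phi^+\rangle$. Write $\beta\preceq\alpha$ if $\alpha-\beta$ is $0$ or a sum of positive roots. A set $S\subseteq\Phi^+$ is a closed pattern if $\beta,\gamma\in S$ and $\beta+\gamma\in\Phi^+$ imply $\beta+\gamma\in S$; then $P(S)=\langle X_\gamma\mid\gamma\in S\rangle$. For $N\subseteq S$ with $S$ a closed pattern, $N\unlhd S$ means: $\beta\in N$, $\gamma\in S$, $\beta+\gamma\in\Phi^+$ imply $\beta+\gamma\in N$; then $N$ is a closed pattern and $P(N)$ is normal in $P(S)$. For $\alpha\in\Phi^+$: $k(\alpha)$ is the largest $N\unlhd\Phi^+$ with $\alpha\notin N$ (equivalently $k(\alpha)=\{\beta\in\Phi^+\mid\beta\not\preceq\alpha\}$). The hook is $h(\alpha)=\{\gamma\in\Phi^+\mid\alpha-\gamma\in\Phi^+\cup\{0\}\}$. An arm $a(\alpha)$ with leg $\ell(\alpha)$ is a pair of subsets such that $h(\alpha)$ is the disjoint union $\{\alpha\}\cup a(\alpha)\cup\ell(\alpha)$, $|a(\alpha)|=|\ell(\alpha)|$, and for each $\beta\in a(\alpha)$ there is a unique $\gamma\in\ell(\alpha)$ with $\beta+\gamma=\alpha$.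 The source is $s(\alpha)=\Phi^+\setminus a(\alpha)$. When (1) and (2) hold put $S_\alpha=P(s(\alpha))$ and $\overline{T}_\alpha=S_\alpha/P(\{\alpha\}\cup\ell(\alpha)\cup k(\alpha))$. Since $s(\alpha)\setminus\{\alpha\}\unlhd s(\alpha)$, the group $X_\alpha$ is identified with $S_\alpha/P(s(\alpha)\setminus\{\alpha\})$, and $\operatorname{Infl}_{X_\alpha}^{S_\alpha}$ is inflation along this quotient map. $\operatorname{Irr}(G)$ is the set of complex irreducible characters of $G$, $\operatorname{Irr}(G)^*=\operatorname{Irr}(G)\setminus\{\mathbf{1}_G\}$, $\lambda^U$ denotes induction, $\operatorname{Infl}$ inflation. For $\chi\in\operatorname{Irr}(UY_n)$ put $\operatorname{rs}(\chi)=\{\gamma\in\Phi^+\mid X_\gamma\subseteq Z(\chi),\ X_\gamma\not\subseteq\ker\chi\}$, and $\operatorname{Irr}(UY_n)_\alpha=\{\chi\in\operatorname{Irr}(UY_n)\mid\operatorname{rs}(\chi)=\{\alpha\}\}$.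
   Formalization: Condition (2) as printed always holds because ℓ(α)∩k(α) is empty, and T̄_α may then be undefined (E6, α=(1,1,1,2,1,1)); admissible arms are also required to satisfy {α}∪ℓ(α)∪k(α) ⊴ s(α), equivalently ℓ(α)∪k(α) ⊴ s(α). *)

(* Defs.v *)
From HB Require Import structures.
From mathcomp Require Import all_boot all_order all_algebra.
From mathcomp Require Import all_fingroup all_solvable all_field all_character.

Set Implicit Arguments.
Unset Strict Implicit.
Unset Printing Implicit Defensive.

Import Order.TTheory GRing.Theory Num.Theory GroupScope.
Local Open Scope ring_scope.

Inductive exc_type := TypeG2 | TypeF4 | TypeE6 | TypeE7 | TypeE8.

Definition rank (Y : exc_type) : nat :=
  match Y with
  | TypeG2 => 2 | TypeF4 => 4 | TypeE6 => 6 | TypeE7 => 7 | TypeE8 => 8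
  end.

(* The edges of the Dynkin diagram of E8 in Bourbaki's numbering, shifted to
   start at 0; the diagrams of E6 and E7 are the full subgraphs on the first
   6 and 7 nodes. *)
Definition E_edges : seq (nat * nat) :=
  [:: (0, 2); (1, 3); (2, 3); (3, 4); (4, 5); (5, 6); (6, 7)]%N.

(* simple_form Y i j is the inner product of the i-th and the j-th simple root,
   normalised so that short roots have squared length 2. *)
Definition simple_form (Y : exc_type) (i j : nat) : int :=
  match Y with
  | TypeG2 => (nth [::] [:: [:: 2; -3]; [:: -3; 6]] i)`_j
  | TypeF4 => (nth [::] [:: [:: 4; -2; 0; 0]; [:: -2; 4; -2; 0];
                       [:: 0; -2; 2; -1]; [:: 0; 0; -1; 2]] i)`_j
  | _ => if i == j then 2 else
         if ((i, j) \in E_edges) || ((j, i) \in E_edges) then -1 else 0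
  end.

(* Elements of the root lattice are the lists of their rank Y coordinates on
   the simple roots. *)
Definition lattice_form (Y : exc_type) (u v : seq int) : int :=
  foldr +%R 0 [seq u`_i * v`_j * simple_form Y i j
              | i <- iota 0 (rank Y), j <- iota 0 (rank Y)].

Definition simple_root (Y : exc_type) (i : nat) : seq int :=
  mkseq (fun j => (i == j)%:R) (rank Y).

Definition vadd (u v : seq int) : seq int := [seq x.1 + x.2 | x <- zip u v].
Definition vscale (z : int) (u : seq int) : seq int := [seq z * x | x <- u].

(* <v, alpha_i^vee> = 2 (v, alpha_i) / (alpha_i, alpha_i), an exact division. *)
Definition cartan_int (Y : exc_type) (v : seq int) (i : nat) : int :=
  (2 * foldr +%R 0 [seq v`_j * simple_form Y j i | j <- iota 0 (rank Y)]
     %/ simple_form Y i i)%Z.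

Definition simple_reflection (Y : exc_type) (i : nat) (v : seq int) : seq int :=
  vadd v (vscale (- cartan_int Y v i) (simple_root Y i)).

(* The orbit of the simple roots under the Weyl group: s collects the lattice
   elements found so far and new those whose reflections are still to be added.
   Thirty rounds suffice in all types: see rootsP below. *)
Fixpoint weyl_closure (Y : exc_type) (k : nat) (s new : seq (seq int)) :=
  if k is k'.+1 then
    let next := undup [seq w <- [seq simple_reflection Y i v
                                | v <- new, i <- iota 0 (rank Y)]
                      | w \notin s] in
    weyl_closure Y k' (s ++ next) next
  else s.

Definition roots (Y : exc_type) : seq (seq int) :=
  let simples := mkseq (simple_root Y) (rank Y) in
  weyl_closure Y 30 simples simples.

Lemma rootsP (Y : exc_type) :
  let s := roots Y in
  all (fun v => all (fun i => simple_reflection Y i v \in s)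
                    (iota 0 (rank Y))) s
  && (size s ==
      match Y with
      | TypeG2 => 12 | TypeF4 => 48 | TypeE6 => 72 | TypeE7 => 126
      | TypeE8 => 240
      end%N).
Proof. by case: Y; vm_compute. Qed.

Definition rootT (Y : exc_type) : finType := seq_sub (roots Y).

Definition posroots (Y : exc_type) : {set rootT Y} :=
  [set g | all (fun x : int => 0 <= x) (val g)].

Definition is_sum (Y : exc_type) (b g d : rootT Y) : bool :=
  val d == vadd (val b) (val g).

Section Patterns.
Variable Y : exc_type.
Implicit Types (S N a l : {set rootT Y}) (alpha : rootT Y).

Definition closed_pattern S : bool :=
  (S \subset posroots Y) &&
  [forall b in S, forall g in S, forall d in posroots Y,
     is_sum b g d ==> (d \in S)].

Definition normal_pattern N S : bool :=
  [&& closed_pattern S, N \subset S &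
   [forall b in N, forall g in S, forall d in posroots Y,
      is_sum b g d ==> (d \in N)]].

(* The largest normal pattern avoiding alpha: the condition defining
   normal_pattern N S is preserved by unions over N. *)
Definition kpat alpha : {set rootT Y} :=
  \bigcup_(N : {set rootT Y} |
             normal_pattern N (posroots Y) && (alpha \notin N)) N.

Definition hook alpha : {set rootT Y} :=
  [set g in posroots Y |
     (g == alpha) || [exists d in posroots Y, is_sum g d alpha]].

Definition is_arm alpha a l : Prop :=
  [/\ hook alpha = alpha |: (a :|: l),
      [/\ alpha \notin a, alpha \notin l & [disjoint a & l]],
      #|a| = #|l| &
      forall b, b \in a -> exists! g, g \in l /\ is_sum b g alpha].

Definition source a : {set rootT Y} := posroots Y :\: a.

Definition Tker alpha l : {set rootT Y} := alpha |: (l :|: kpat alpha).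

(* An arm with closed source s and l :&: k normal in s, for which the quotient
   of P(s) by P({alpha} u l u k) is defined.  The last clause cannot be left
   out: l :&: k is always empty, since the elements of the hook lie below alpha
   and those of k do not, so that the third clause alone does not make
   {alpha} u l u k normal in s. *)
Definition good_arm alpha a l : Prop :=
  [/\ is_arm alpha a l,
      closed_pattern (source a),
      normal_pattern (l :&: kpat alpha) (source a) &
      normal_pattern (Tker alpha l) (source a)].

End Patterns.

(* A Chevalley basis consists of the h_i, where h_i is the coroot of the i-th
   simple root, and of the e_g for g a root. *)
Definition chev_index (Y : exc_type) : finType := ('I_(rank Y) + rootT Y)%type.

Section LieAlgebra.
Variables (Y : exc_type) (N : rootT Y -> rootT Y -> int).
Implicit Types (g d : rootT Y) (b c : chev_index Y).

Local Notation lieZ := {ffun chev_index Y -> int}.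

Definition basis_vec b : lieZ := [ffun c => (c == b)%:R].

(* If g = \sum_i c_i alpha_i then
   g^vee = \sum_i (c_i (alpha_i, alpha_i) / (g, g)) alpha_i^vee. *)
Definition coroot_vec g : lieZ :=
  \sum_(i < rank Y)
    basis_vec (inl i) *~ ((val g)`_i * simple_form Y i i
                            %/ lattice_form Y (val g) (val g))%Z.

Definition basis_bracket b c : lieZ :=
  match b, c with
  | inl _, inl _ => 0
  | inl i, inr g => basis_vec (inr g) *~ cartan_int Y (val g) i
  | inr g, inl i => - (basis_vec (inr g) *~ cartan_int Y (val g) i)
  | inr g, inr d =>
      if val d == vscale (-1) (val g) then coroot_vec g
      else \sum_(e | is_sum g d e) basis_vec (inr e) *~ N g d
  end.

Definition bracket (u v : lieZ) : lieZ :=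
  \sum_b \sum_c basis_bracket b c *~ (u b * v c).

(* The largest r such that d - r g is a root; root strings have at most four
   elements. *)
Definition string_down g d : nat :=
  \max_(r < 4 | vadd (val d) (vscale (- r%:Z) (val g)) \in roots Y) r.

(* N is the family of structure constants of a Chevalley basis: bracket is a
   Lie bracket and [e_g, e_d] = +-(r + 1) e_(g + d), with r as in string_down,
   when g + d is a root. *)
Definition chevalley_constants : Prop :=
  [/\ forall u, bracket u u = 0,
      forall u v w, bracket u (bracket v w) + bracket v (bracket w u)
                    + bracket w (bracket u v) = 0 &
      forall g d e, is_sum g d e -> `|N g d|%N = (string_down g d).+1].

(* The coefficient on c of (ad e_g)^i / i! applied to the basis element b. *)
Definition ad_divpow g (i : nat) b c : int :=
  ((iter i (bracket (basis_vec (inr g))) (basis_vec b) : lieZ) c %/ i`!)%Z.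

Variable F : finFieldType.

Definition lieF : finType := {ffun chev_index Y -> F}.

(* x_g(t) = exp (t ad e_g) on F (x) L_Z; the powers (ad e_g)^i vanish for
   i >= 4. *)
Definition xroot g (t : F) (u : lieF) : lieF :=
  [ffun c => \sum_b u b * \sum_(i < 4) t ^+ i * (ad_divpow g i b c)%:~R].

(* The permutations of F (x) L_Z of the form x_g(t).  The product of {perm _}
   is composition in the order opposite to that of functions; as
   x_g(t)^-1 = x_g(- t), inversion identifies the resulting groups with the
   usual ones, root subgroup by root subgroup. *)
Definition rootsub g : {set {perm lieF}} :=
  [set s : {perm lieF} | [exists t, [forall u, s u == xroot g t u]]].

Definition Pgrp (S : {set rootT Y}) : {group {perm lieF}} :=
  <<\bigcup_(g in S) rootsub g>>%G.

Definition Ugrp : {group {perm lieF}} := Pgrp (posroots Y).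

Definition rset (chi : 'CF(Ugrp)) : {set rootT Y} :=
  [set g in posroots Y |
     (rootsub g \subset 'Z(chi)%CF) && ~~ (rootsub g \subset cfker chi)].

Definition irr_single (alpha : rootT Y) : pred 'CF(Ugrp) :=
  fun chi => (chi \in irr Ugrp) && (rset chi == [set alpha]).

Definition Salpha (a : {set rootT Y}) : {group {perm lieF}} := Pgrp (source a).

Definition TkerG (alpha : rootT Y) (l : {set rootT Y}) : {group {perm lieF}} :=
  Pgrp (Tker alpha l).

Definition Talpha (alpha : rootT Y) (a l : {set rootT Y}) :=
  (Salpha a / TkerG alpha l)%G.

(* X_alpha, being a group, is the group it generates. *)
Definition Xalpha (alpha : rootT Y) : {group {perm lieF}} := Pgrp [set alpha].

Definition irr_pairs (alpha : rootT Y) (a l : {set rootT Y}) :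
    pred ('CF(Talpha alpha a l) * 'CF(Xalpha alpha)) :=
  fun ml => [&& ml.1 \in irr (Talpha alpha a l),
                ml.2 \in irr (Xalpha alpha) & ml.2 != 1].

(* The hypothesis defS expresses the identification of X_alpha with the
   quotient of S_alpha by P(s(alpha) \ {alpha}); cfSdprod is inflation along
   it. *)
Definition Psi (alpha : rootT Y) (a l : {set rootT Y})
    (defS : Pgrp (source a :\ alpha) ><| Xalpha alpha = Salpha a)
    (ml : 'CF(Talpha alpha a l) * 'CF(Xalpha alpha)) : 'CF(Ugrp) :=
  'Ind[Ugrp] ((ml.1 %% TkerG alpha l)%CF * cfSdprod defS ml.2).

End LieAlgebra.

Arguments irr_single {Y} N F alpha chi.
Arguments irr_pairs {Y} N F alpha a l ml.
Arguments Psi {Y} N F alpha a l defS ml.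

Definition bijection_on (A B : Type) (P : pred A) (Q : pred B) (f : A -> B) :=
  [/\ forall x, P x -> Q (f x),
      forall x y, P x -> P y -> f x = f y -> x = y &
      forall z, Q z -> exists2 x, P x & f x = z].

(* Main.v *)
(* Every arm (a, l) satisfying the hypotheses works.  Order the roots of the arm by
   height and remove them from it one at a time, the highest first.  Let A be the part
   that remains, and K(A) the union of k(alpha) and of the alpha - b with b in A.
   Removing b from A enlarges P(s(A)) by X_b and shrinks its normal subgroup P(K(A))
   by X_(alpha - b); commutation pairs X_b and X_(alpha - b) perfectly into X_alpha,
   which is central modulo the smaller kernel.
   Hence, by Clifford theory, induction is a bijection between the irreducible
   characters with the larger kernel that are nontrivial on X_alpha and those of
   the larger group with the smaller kernel that are nontrivial on X_alpha.  Before
   the first step these characters are the products of inflations of the theorem;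
   after the last one they are those of UY trivial on P(k(alpha)) but not on X_alpha,
   that is, those with single root alpha.

   The commutator relation of x_g and x_d is an identity between exponentials of
   nilpotent matrices: it is proved over a field of characteristic 0 by comparing
   two solutions of a linear differential equation, and specialised from polynomial
   matrices over the integers to the finite field.  The facts on root strings which
   it needs are checked by computation. *)

Require Import Defs.
From mathcomp Require Import all_boot all_order all_algebra.
From mathcomp Require Import all_fingroup all_solvable all_field all_character.
From mathcomp Require Import ring.
Import Defs.

Set Implicit Arguments.
Unset Strict Implicit.
Unset Printing Implicit Defensive.

Import Order.TTheory GRing.Theory Num.Theory GroupScope.
Local Open Scope ring_scope.

(** * Clifford theory *)

(** Two features of the commutator of x_g and x_d carry the argument: the coefficient of x_(g + d),
    which must be nonzero in the field, and the set of roots occurring in the other factors. The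
    coefficient is [N g d] up to sign. For positive roots its absolute value is at most 3 in type
    G2, 2 in type F4 and 1 in types E, and the bounds on p make these values invertible.
    Exponentials with denominators up to 3! make no sense over the field when p is 2 or 3, which
    types E allow. The divided powers of ad e_g are integral, though, so that the relation is a
    polynomial identity in t and u over the integers, apart from a denominator 2 in type G2, and can
    be verified where division is possible. A commutator is a product of several root elements, so a
    kernel that contains it may fail to contain the root subgroups involved. This is the obstacle in
    identifying the characters with single root alpha, and it is met by following leading roots
    only. That X_alpha meets P(s(alpha) \ {alpha}) trivially is read off the action on the Cartan
    part of the Lie algebra. *)

Lemma bijection_on_comp (A B C : Type) (P : pred A) (Q : pred B) (R : pred C)
    (f : A -> B) (g : B -> C) :
  bijection_on P Q f -> bijection_on Q R g -> bijection_on P R (g \o f).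
Proof.
move=> [fP fI fS] [gP gI gS]; split=> [x Px | x y Px Py | z Rz] /=.
- exact/gP/fP.
- by move/(gI _ _ (fP _ Px) (fP _ Py)); apply: fI.
- by have [y Qy <-] := gS z Rz; have [x Px <-] := fS y Qy; exists x.
Qed.

Lemma bijection_on_eq (A B : Type) (P : pred A) (Q Q' : pred B) (f g : A -> B) :
  f =1 g -> Q =1 Q' -> bijection_on P Q f -> bijection_on P Q' g.
Proof.
move=> fg QQ' [fQ fI fS]; split=> [x Px | x y Px Py | z]; rewrite -?fg -?QQ'; auto.
by move=> /fS[x Px <-]; exists x.
Qed.

Definition irr_over (gT : finGroupType) (G : {group gT}) (M Z : {set gT}) :
    pred 'CF(G) :=
  fun chi => [&& chi \in irr G, M \subset cfker chi & ~~ (Z \subset cfker chi)].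
Arguments irr_over {gT} G M Z chi.

Lemma char_mul_center (gT : finGroupType) (G : {group gT}) (chi : 'CF(G)) x z :
    chi \is a character -> x \in G -> z \in 'Z(chi)%CF ->
  chi (x * z)%g * chi 1%g = chi x * chi z.
Proof.
move=> /char_reprP[[n rG] ->] Gx /=; rewrite cfcenter_repr => Zz.
have Gz: z \in G by move: Zz; rewrite inE => /andP[].
move: Zz; rewrite inE => /andP[_ /is_scalar_mxP[a Ea]].
rewrite !cfunE !groupM ?group1 ?Gx ?Gz //= !mulr1n repr_mxM // Ea.
by rewrite repr_mx1 mxtrace1 mul_mx_scalar mxtraceZ mxtrace_scalar -mulr_natr; ring.
Qed.

(** For irreducible [chi] the centre of [chi] modulo its kernel is the whole centre of
    [G / cfker chi], and being central there is a statement on commutators. *)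
Lemma sub_cfcenter_irr (gT : finGroupType) (G A : {group gT})
    (chi : 'CF(G)) :
    chi \in irr G -> A \subset G ->
  (A \subset 'Z(chi)%CF) = ([~: A, G] \subset cfker chi).
Proof.
case/irrP=> i -> sAG; have [sKZ _] := andP (cfker_center_normal 'chi_i).
have nKG := normal_norm (cfker_normal 'chi_i).
rewrite -quotient_cents2 ?(subset_trans sAG nKG) //.
have /esym := @quotientSGK _ _ A (cfcenter_group 'chi_i) (subset_trans sAG nKG) sKZ.
by move=> /= ->; rewrite cfcenter_eq_center subsetI (quotientS _ sAG).
Qed.

Section CliffordReduction.

Variables (gT : finGroupType) (G H M Y Z : {group gT}).
Hypotheses (nsHG : H <| G) (nsMG : M <| G) (sMY : M \subset Y).
Hypotheses (nsYH : Y <| H) (sZH : Z \subset H) (cZG : [~: Z, G] \subset M).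

(** [Z] is central modulo [M], so the conjugates of [z] stay in the coset of [z] modulo [M], on
    which [psi] is constant. *)
Lemma cfInd_central (psi : 'CF(H)) z :
    M \subset cfker psi -> z \in Z ->
  'Ind[G] psi z = (#|G|%:R / #|H|%:R) * psi z.
Proof.
move=> kM Zz; rewrite cfIndE ?normal_sub // (eq_bigr (fun _ => psi z)).
  by rewrite sumr_const -[psi z *+ _]mulr_natl mulrA (mulrC _^-1).
move=> y Gy; rewrite conjg_mulR cfkerMr //.
by apply: (subsetP kM); apply: (subsetP cZG); apply: mem_commg.
Qed.

Hypothesis pairH : forall g z, g \in G :\: H -> z \in Z ->
  exists2 y, y \in Y & [~ y, g] \in (z *: M)%g.

(** Frobenius reciprocity and Clifford's formula turn the left side into a sum of products of [psi]
    with the conjugates of [phi]. An element [g] outside [H] cannot conjugate [phi] to [psi]: [Y]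
    lies in the kernel of [psi], while [g] multiplies some element of [Y] by an element of [Z]
    outside the kernel of [phi]. *)
Lemma cfdot_Ind_over (psi phi : 'CF(H)) :
    psi \in irr_over H Y Z -> phi \in irr_over H Y Z ->
  '['Ind[G] psi, 'Ind[G] phi] = '[psi, phi].
Proof.
move=> /and3P[/irrP[i ->] kYi _] /and3P[/irrP[j ->] kYj nkZ].
have [sHG nHG] := andP nsHG; have sYH := normal_sub nsYH.
rewrite -cfdot_Res_r cfResInd // cfdotZr fmorphV rmorph_nat cfdot_sumr.
rewrite (big_setID H) /= (setIidPr sHG) [X in _ + X]big1 ?addr0 => [|g GHg].
  rewrite -[RHS](mulKf (neq0CG H)); congr (_ * _); rewrite mulr_natl -sumr_const.
  by apply: eq_bigr => y Hy; rewrite cfConjg_id.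
have /setDP[Gg notHg] := GHg.
have /subsetPn[z Zz kz] := nkZ.
(* The value of [phi ^ g] at [y] is that of [phi] at [y ^ g^-1], so the pairing is applied to the
   inverse of [g]. *)
have GHgV: g^-1%g \in G :\: H by rewrite inE !groupV notHg.
have [y Yy] := pairH GHgV Zz; case/lcosetP=> m Mm def_yg.
rewrite -conjg_IirrE cfdot_irr; case: eqP => // eq_ij.
have eqij: 'chi_i = ('chi_j ^ g)%CF by rewrite -conjg_IirrE -eq_ij.
case/negP: kz; rewrite cfkerEirr inE.
have kjM := subset_trans sMY kYj.
have Hy := subsetP sYH _ Yy.
have := cfker1 (subsetP kYi _ Yy); rewrite eqij cfConjg1 => <-.
rewrite cfConjgE ?(subsetP nHG) // conjg_mulR def_yg.
by rewrite cfkerMl ?(subsetP kYj) // cfkerMr ?(subsetP kjM) // eqxx.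
Qed.

Hypothesis pairY : forall y z, y \in Y :\: M -> z \in Z ->
  exists2 g, g \in G & [~ y, g] \in (z *: M)%g.

(** [y] is conjugate to [y * z * m] with [m] in the kernel, and [z] acts as a scalar other than 1;
    hence [chi y] is a proper multiple of itself. *)
Lemma irr_over_vanish (chi : 'CF(G)) y :
  chi \in irr_over G M Z -> y \in Y :\: M -> chi y = 0.
Proof.
case/and3P=> irr_chi kM /subsetPn[z Zz kz] YMy; have /setDP[Yy _] := YMy.
have [sHG nHG] := andP nsHG; have sYH := normal_sub nsYH.
have Gy: y \in G by rewrite (subsetP sHG) ?(subsetP sYH).
have [g Gg] := pairY YMy Zz; case/lcosetP=> m Mm def_yg.
have Nchi := irrWchar irr_chi.
have ZZ: Z \subset 'Z(chi)%CF.
  by rewrite sub_cfcenter_irr ?(subset_trans cZG) ?(subset_trans sZH).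
have := char_mul_center Nchi Gy (subsetP ZZ _ Zz).
have -> : chi (y * z)%g = chi y.
  by rewrite -[RHS](cfunJ _ _ Gg) conjg_mulR def_yg mulgA [RHS]cfkerMr ?(subsetP kM).
move/eqP; rewrite -subr_eq0 -mulrBr mulf_eq0 subr_eq0 => /orP[/eqP // | /eqP eq_z].
case/negP: kz; case/irrP: irr_chi eq_z => i -> eq_z.
by rewrite cfkerEirr inE eq_z.
Qed.

Theorem Ind_irr_over_bij :
  bijection_on (irr_over H Y Z) (irr_over G M Z) 'Ind[G].
Proof.
have [sHG nHG] := andP nsHG; have sYH := normal_sub nsYH.
have sMH := subset_trans sMY sYH.
split=> [psi Opsi | psi phi Opsi Ophi eq_Ind | chi Ochi].
- have /and3P[irr_psi kY /subsetPn[z Zz kz]] := Opsi.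
  have kM := subset_trans sMY kY.
  apply/and3P; split.
  + rewrite irrEchar cfInd_char ?irrWchar //= cfdot_Ind_over //.
    by case/irrP: irr_psi => i ->; rewrite cfnorm_irr.
  + case/irrP: irr_psi kM => i -> kM; rewrite cfker_Ind_irr //.
    by rewrite sub_gcore // normal_norm.
  apply/subsetPn; exists z => //; apply: contra kz => /cfker1.
  rewrite !cfInd_central // => /mulfI eq_z.
  case/irrP: irr_psi eq_z => i -> eq_z.
  rewrite cfkerEirr inE eq_z //.
  by rewrite mulf_neq0 ?invr_eq0 ?neq0CG.
- have := cfdot_Ind_over Opsi Ophi; rewrite eq_Ind cfdot_Ind_over //.
  case/and3P: Opsi Ophi => /irrP[i ->] _ _ /and3P[/irrP[j ->] _ _].
  by rewrite cfnorm_irr cfdot_irr; case: eqP => [-> // | _ /eqP]; rewrite oner_eq0.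
have vanish := irr_over_vanish Ochi.
have /and3P[irr_chi kM /subsetPn[z Zz kz]] := Ochi.
have Nchi := irrWchar irr_chi.
have sYG := subset_trans sYH sHG.
(* Only [M] contributes to the sum over [Y], so the trivial character of [Y] occurs in [chi]. As [Y]
   is normal in [H], a constituent over [H] in which it occurs has [Y] in its kernel; this
   constituent is the preimage sought. *)
have nz1: '['Res[Y] chi, 1] != 0.
  rewrite cfdotE mulf_neq0 ?invr_eq0 ?neq0CG // (big_setID M) /= (setIidPr sMY).
  rewrite [X in _ + X]big1 ?addr0 => [|y YMy].
    rewrite (eq_bigr (fun _ => chi 1%g)) => [|m Mm].
      rewrite sumr_const -mulr_natr mulf_neq0 ?neq0CG //.
      by case/irrP: irr_chi => i ->; rewrite irr1_neq0.
    have Ym := subsetP sMY _ Mm.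
    by rewrite cfResE // cfun1E Ym rmorph1 mulr1 cfker1 ?(subsetP kM).
  by have /setDP[Yy _] := YMy; rewrite cfResE // vanish // mul0r.
have [i ci nzi]: exists2 i, i \in irr_constt ('Res[H] chi)
                     & '['Res[Y] 'chi_i, 1] != 0.
  apply/exists_inP; apply: contraR nz1; rewrite negb_exists_in => /forall_inP z1.
  rewrite -(cfResRes _ sYH sHG) ['Res[H] chi]cfun_sum_constt linear_sum /=.
  rewrite cfdot_suml big1 // => i ci; rewrite linearZ /= cfdotZl.
  by have := z1 i ci; rewrite negbK => /eqP->; rewrite mulr0.
have kY: Y \subset cfker 'chi_i.
  by apply: constt0_Res_cfker; rewrite // irr_consttE irr0.
have kMi := subset_trans sMY kY.
have /irrP[j def_chi] := irr_chi.
have ij: '['chi_i, 'Res[H] 'chi_j] != 0.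
  by rewrite cfdotC fmorph_eq0 -irr_consttE -def_chi.
suff nkZ: ~~ (Z \subset cfker 'chi_i).
  have Oi: 'chi_i \in irr_over H Y Z by apply/and3P; rewrite mem_irr.
  exists 'chi_i => //.
  have: 'Ind[G] 'chi_i \in irr G.
    rewrite irrEchar cfInd_char ?irr_char //= cfdot_Ind_over //.
    by rewrite cfnorm_irr.
  case/irrP=> k def_k; rewrite cfdot_Res_r def_k cfdot_irr in ij.
  by rewrite def_k def_chi; case: (k =P j) ij => [-> // | _]; rewrite eqxx.
(* On [Z] the induced character is a multiple of ['chi_i], so [Z] would lie in its kernel and then
   in the kernel of its constituent [chi]. *)
apply: contra kz => kZ; have kjZ: Z \subset cfker ('Ind[G] 'chi_i).
  rewrite cfkerEchar ?cfInd_char ?irr_char //.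
  apply/subsetP=> x Zx; rewrite inE (subsetP sHG) ?(subsetP sZH) //=.
  by rewrite !cfInd_central // cfker1 ?(subsetP kZ).
rewrite def_chi; apply: subsetP _ _ Zz; apply: subset_trans kjZ _.
by apply: cfker_constt; rewrite ?cfInd_char ?irr_char // irr_consttE -cfdot_Res_r.
Qed.
End CliffordReduction.

Lemma mem_cfker_irr (gT : finGroupType) (G : {group gT}) (chi : 'CF(G)) x :
  chi \in irr G -> (x \in cfker chi) = (chi x == chi 1%g).
Proof. by case/irrP=> i ->; rewrite cfkerEirr inE. Qed.

(** * Products of inflated characters *)

Section InflationProduct.

Variables (gT : finGroupType) (S T L X B : {group gT}).
Hypothesis defS : B ><| X = S.
Hypotheses (nsTS : T <| S) (sLT : L \subset T) (sXT : X \subset T).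
Hypotheses (sTLX : T \subset L <*> X) (sLB : L \subset B).
Hypotheses (abX : abelian X) (cXS : [~: X, S] \subset L).

Let sXS : X \subset S. Proof. by case/sdprod_context: defS. Qed.

Definition infl_mul (ml : 'CF(S / T) * 'CF(X)) : 'CF(S) :=
  (ml.1 %% T)%CF * cfSdprod defS ml.2.

Let lin_irr_X (lam : 'CF(X)) : lam \in irr X -> lam \is a linear_char.
Proof. by case/irrP=> i ->; apply/char_abelianP. Qed.

Let infl_mulX (mu : 'CF(S / T)) (lam : 'CF(X)) x :
  x \in X -> infl_mul (mu, lam) x = mu 1%g * lam x.
Proof.
move=> Xx; rewrite /infl_mul cfunE cfSdprodEr //.
by rewrite (cfker1 (subsetP (cfker_mod mu nsTS) x (subsetP sXT x Xx))) cfMod1.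
Qed.

(** Since [X] is central modulo [L], a character [psi] of the target restricts to [X] as a multiple
    of a linear character [lam]. Dividing [psi] by the extension of [lam] to [S], that is,
    multiplying by its conjugate, leaves a character trivial on [L] and on [X], hence on [T].
    Conversely the values of a product on [X] determine [lam], and then [mu]. *)
Lemma infl_mul_bij :
  bijection_on (fun ml => [&& ml.1 \in irr (S / T), ml.2 \in irr X & ml.2 != 1])
               (irr_over S L X) infl_mul.
Proof.
split=> [[mu lam] /and3P[/= irr_mu irr_lam nt_lam] | |].
- have lin_lam := lin_irr_X irr_lam.
  have irr_prod : infl_mul (mu, lam) \in irr S.
    by rewrite /infl_mul mulrC mul_lin_irr ?cfMod_irr ?cfSdprod_lin_char.
  rewrite /irr_over irr_prod /=; apply/andP; split.
    apply: subset_trans (cfker_mul _ _); rewrite subsetI.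
    rewrite (subset_trans sLT) ?cfker_mod //=.
    by apply: subset_trans sLB (cfker_sdprod _ _).
  apply: contra nt_lam => kX; apply/eqP/cfun_inP=> x Xx; rewrite cfun1E Xx.
  have := cfker1 (subsetP kX x Xx); rewrite !infl_mulX ?group1 // lin_char1 //.
  by apply: mulfI; case/irrP: irr_mu => i ->; apply: irr1_neq0.
- move=> [mu1 lam1] [mu2 lam2] /and3P[/= irr_mu1 irr_lam1 _] /and3P[/= irr_mu2 irr_lam2 _] eq12.
  have [lin1 lin2] := (lin_irr_X irr_lam1, lin_irr_X irr_lam2).
  have eq_mu1 : mu1 1%g = mu2 1%g.
    have := congr1 (fun phi : 'CF(S) => phi 1%g) eq12.
    by rewrite /= !infl_mulX // (lin_char1 lin1) (lin_char1 lin2) !mulr1.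
  have eq_lam : lam1 = lam2.
    apply/cfun_inP=> x Xx; have := congr1 (fun phi : 'CF(S) => phi x) eq12.
    rewrite /= !infl_mulX // eq_mu1; apply: mulfI.
    by case/irrP: irr_mu2 => i ->; apply: irr1_neq0.
  congr (_, _) => //; apply: (can_inj (cfModK nsTS)); apply/cfun_inP=> s Ss.
  have := congr1 (fun phi : 'CF(S) => phi s) eq12.
  rewrite /= /infl_mul /= eq_lam !cfunE; apply: mulIf.
  by rewrite lin_char_neq0 ?cfSdprod_lin_char.
move=> psi /and3P[irr_psi kL nkX]; have Npsi := irrWchar irr_psi.
have ZX : X \subset 'Z(psi)%CF by rewrite sub_cfcenter_irr // (subset_trans cXS).
have [lam0 lin0 def0] := cfcenter_Res psi.
have psi1 : psi 1%g != 0 by case/irrP: irr_psi => i ->; apply: irr1_neq0.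
pose lam := 'Res[X] lam0; have lin_lam : lam \is a linear_char by apply: cfRes_lin_char.
have psiX x : x \in X -> psi x = psi 1%g * lam x.
  move=> Xx; have Zx := subsetP ZX x Xx; rewrite cfResE //.
  by rewrite -(cfResE psi (cfcenter_sub psi) Zx) def0 cfunE.
pose Lam := cfSdprod defS lam; have linL : Lam \is a linear_char by rewrite cfSdprod_lin_char.
pose phi := psi * Lam^*%CF.
have irr_phi : phi \in irr S by rewrite /phi mulrC mul_lin_irr // cfConjC_lin_char.
have kT : T \subset cfker phi.
  apply: subset_trans sTLX _; rewrite join_subG; apply/andP; split.
    apply: subset_trans (cfker_mul _ _); rewrite subsetI kL cfker_aut.
    exact: subset_trans sLB (cfker_sdprod _ _).
  apply/subsetP=> x Xx; rewrite mem_cfker_irr //; apply/eqP.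
  rewrite !cfunE psiX // cfSdprodEr // (lin_char1 linL) rmorph1 mulr1 -mulrA -normCK.
  by rewrite normC_lin_char // expr1n mulr1.
have irr_mu : (phi / T)%CF \in irr (S / T) by rewrite cfQuo_irr.
exists ((phi / T)%CF, lam).
  apply/and3P; split=> //=; first exact: lin_char_irr.
  apply: contra nkX => /eqP lam1; apply/subsetP=> x Xx.
  rewrite mem_cfker_irr //; apply/eqP.
  by rewrite psiX // lam1 cfun1E Xx mulr1.
rewrite /infl_mul /= cfQuoK //; apply/cfun_inP=> s Ss; rewrite !cfunE -mulrA.
by rewrite [_^* * _]mulrC -normCK normC_lin_char // expr1n mulr1.
Qed.

End InflationProduct.

(** * Truncated exponentials *)

Section Exponential.

Variables (K : fieldType) (E : algType K).
Hypothesis natK_neq0 : forall n, n.+1%:R != 0 :> K.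
Implicit Types (a b r z : E) (f p : {poly E}).

Let mulrn_inj n a : a *+ n.+1 = 0 -> a = 0.
Proof.
by rewrite -scaler_nat => /eqP; rewrite scaler_eq0 (negPf (natK_neq0 n)) => /eqP.
Qed.

Let invfactS n : ((n.+1)`!%:R : K)^-1 *+ n.+1 = (n`!%:R)^-1.
Proof. by rewrite -[LHS]mulr_natl factS natrM invfM mulrA mulfV ?mul1r. Qed.

(** The equation expresses n + 1 times the coefficient of degree n + 1 through the lower ones, and n
    + 1 is invertible. *)
Lemma poly_ode0 f p : f^`() = p * f -> f`_0 = 0 -> f = 0.
Proof.
move=> ode f0; apply/polyP => n; rewrite coef0.
elim/ltn_ind: n => -[//|n] IHn; apply: (@mulrn_inj n).
rewrite -coef_deriv ode coefM big1 // => i _.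
by rewrite IHn ?mulr0 // ltnS leq_subr.
Qed.

Lemma poly_ode f1 f2 p :
  f1^`() = p * f1 -> f2^`() = p * f2 -> f1`_0 = f2`_0 -> f1 = f2.
Proof.
move=> ode1 ode2 eq0; apply/eqP; rewrite -subr_eq0; apply/eqP.
apply: (@poly_ode0 _ p); last by rewrite coefB eq0 subrr.
by rewrite derivB ode1 ode2 mulrBr.
Qed.

(* Root strings have at most four elements, hence so many terms suffice. *)
Definition exp4 a : E := \sum_(i < 4) (i`!%:R)^-1 *: a ^+ i.

Definition exp4T a : {poly E} := \poly_(i < 4) ((i`!%:R)^-1 *: a ^+ i).

Lemma exp4T1 a : (exp4T a).[1] = exp4 a.
Proof. by rewrite horner_poly; apply: eq_bigr => i _; rewrite expr1n mulr1. Qed.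

Lemma exp4T_coef0 a : (exp4T a)`_0 = 1.
Proof. by rewrite coef_poly /= invr1 scale1r expr0. Qed.

Lemma deriv_exp4T a : a ^+ 4 = 0 -> (exp4T a)^`() = a%:P * exp4T a.
Proof.
move=> a4; apply/polyP => i; rewrite coef_deriv coefCM !coef_poly.
case: i => [|[|[|[|i]]]] //=; last by rewrite mul0rn mulr0.
- by rewrite scalerMnl invfactS -scalerAr -exprS.
- by rewrite scalerMnl invfactS -scalerAr -exprS.
- by rewrite scalerMnl invfactS -scalerAr -exprS.
- by rewrite mul0rn -scalerAr -exprS a4 scaler0.
Qed.

(** The equation for [r] is that of the conjugate of [r0] by exp (T a). Both sides solve f' = a f
    with the same initial value. *)
Lemma exp4T_conj a r0 (r : {poly E}) :
    a ^+ 4 = 0 -> r^`() = a%:P * r - r * a%:P -> r`_0 = r0 ->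
  exp4T a * r0%:P = r * exp4T a.
Proof.
move=> a4 dr eq_r0; apply: (@poly_ode _ _ a%:P).
- by rewrite derivM derivC mulr0 addr0 deriv_exp4T // mulrA.
- by rewrite derivM dr deriv_exp4T // mulrBl !mulrA subrK.
- by rewrite !coefM !big_ord1 exp4T_coef0 coefC eq_r0 mul1r mulr1.
Qed.

Lemma exp4TN a : a ^+ 4 = 0 -> exp4T a * exp4T (- a) = 1.
Proof.
move=> a4; have Na4: (- a) ^+ 4 = 0 by rewrite exprNn a4 mulr0.
apply: (@poly_ode _ _ 0).
- rewrite derivM deriv_exp4T // deriv_exp4T // mul0r polyCN mulNr mulrN.
  rewrite mulrA (@exp4T_conj a a a%:P) ?coefC ?derivC ?subrr ?mulrA //.
- by rewrite -[1]/(1%:P) derivC mul0r.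
- by rewrite coefM big_ord1 !exp4T_coef0 mulr1 coefC.
Qed.

Lemma exp4N a : a ^+ 4 = 0 -> exp4 a * exp4 (- a) = 1.
Proof.
move=> /exp4TN/(congr1 (horner^~ 1)).
by rewrite /= hornerM_comm ?exp4T1 ?hornerC // /comm_poly mul1r mulr1.
Qed.

Lemma exp4D a b : a ^+ 4 = 0 -> b ^+ 4 = 0 -> (a + b) ^+ 4 = 0 ->
  GRing.comm a b -> exp4 (a + b) = exp4 a * exp4 b.
Proof.
move=> a4 b4 ab4 cab.
suff /(congr1 (horner^~ 1)): exp4T (a + b) = exp4T a * exp4T b.
  by rewrite /= hornerM_comm ?exp4T1 // /comm_poly mul1r mulr1.
apply: (@poly_ode _ _ (a + b)%:P); first by rewrite deriv_exp4T.
- rewrite derivM !deriv_exp4T // polyCD mulrDl !mulrA; congr (_ + _ * _).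
  apply: exp4T_conj; rewrite ?coefC ?derivC // -!polyCM -polyCB.
  by rewrite cab subrr.
- by rewrite coefM big_ord1 !exp4T_coef0 mulr1.
Qed.

Lemma exp4_conj a b r :
    a ^+ 4 = 0 -> b ^+ 4 = 0 -> exp4 a * b = r * exp4 a ->
  r ^+ 4 = 0 /\ exp4 a * exp4 b * exp4 (- a) = exp4 r.
Proof.
move=> a4 b4 abr.
have eX n : exp4 a * b ^+ n = r ^+ n * exp4 a.
  elim: n => [|n IHn]; first by rewrite !expr0 mul1r mulr1.
  by rewrite !exprSr mulrA IHn -mulrA abr mulrA.
split; first by rewrite -[LHS]mulr1 -(exp4N a4) mulrA -eX b4 mulr0 mul0r.
move: (exp4N a4) eX; move: (exp4 a) (exp4 (- a)) => e f ef eX.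
rewrite /exp4 mulr_sumr mulr_suml; apply: eq_bigr => i _.
by rewrite -scalerAr -scalerAl eX -mulrA ef mulr1.
Qed.

Section StringConjugation.

(* y0, y1, y2, y3 is the divided adjoint string (ad a)^i / i! of y0; the only
   nonzero commutators of its members are [y0, y1], [y0, y3] and [y1, y2], and
   these are central. *)
Variables (a y0 y1 y2 y3 w0 w1 w2 : E).
Hypotheses (a4 : a ^+ 4 = 0) (y04 : y0 ^+ 4 = 0) (y14 : y1 ^+ 4 = 0).
Hypotheses (y24 : y2 ^+ 4 = 0) (y34 : y3 ^+ 4 = 0).
Hypotheses (ay0 : a * y0 - y0 * a = y1) (ay1 : a * y1 - y1 * a = y2 *+ 2).
Hypotheses (ay2 : a * y2 - y2 * a = y3 *+ 3) (ay3 : a * y3 - y3 * a = 0).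
Hypotheses (c02 : GRing.comm y0 y2).
Hypotheses (c13 : GRing.comm y1 y3) (c23 : GRing.comm y2 y3).
Hypothesis d01 : y0 * y1 - y1 * y0 = w0 *+ 2.
Hypotheses (d03 : y0 * y3 - y3 * y0 = w1 *+ 2) (d12 : y1 * y2 - y2 * y1 = w2 *+ 2).
Hypotheses (cw00 : GRing.comm y0 w0) (cw10 : GRing.comm y0 w1) (cw20 : GRing.comm y0 w2).
Hypotheses (cw01 : GRing.comm y1 w0) (cw11 : GRing.comm y1 w1) (cw21 : GRing.comm y1 w2).
Hypotheses (cw02 : GRing.comm y2 w0) (cw12 : GRing.comm y2 w1) (cw22 : GRing.comm y2 w2).
Hypotheses (cw03 : GRing.comm y3 w0) (cw13 : GRing.comm y3 w1) (cw23 : GRing.comm y3 w2).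
Hypothesis w4 : (w0 + w1 + w2) ^+ 4 = 0.

Let w := w0 + w1 + w2.

(** This is exp (T^2 z): [z ^+ 4 = 0] removes all terms beyond T^6. The square appears because the
    commutators of members of the string, each scaled by T, scale by T^2. *)
Let exp4T2 z : {poly E} :=
  \poly_(i < 7) (if odd i then 0 else (i./2`!%:R)^-1 *: z ^+ i./2).

Let deriv_exp4T2 z :
  z ^+ 4 = 0 -> (exp4T2 z)^`() = (z *+ 2)%:P * 'X * exp4T2 z.
Proof.
move=> z4; apply/polyP => i; rewrite -mulrA coef_deriv coefCM coefXM !coef_poly.
do 8?[case: i => [|i]] => //=; rewrite ?mulr0 ?mul0rn //.
- by rewrite -scalerAr mulrnAl -exprS -scalerMnr -(invfactS 0) -scalerMnl -mulrnA.
- by rewrite -scalerAr mulrnAl -exprS -scalerMnr -(invfactS 1) -scalerMnl -mulrnA.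
- by rewrite -scalerAr mulrnAl -exprS -scalerMnr -(invfactS 2) -scalerMnl -mulrnA.
- by rewrite -scalerAr mulrnAl -exprS z4 mul0rn scaler0.
Qed.

Let horner1M p1 p2 : (p1 * p2).[1] = p1.[1] * p2.[1] :> E.
Proof. by rewrite hornerM_comm // /comm_poly mul1r mulr1. Qed.

(** Conjugation by exp a is exp (ad a), so the left side is exp y with y the sum of the string. On
    the right, scale the members by T: the product of the four exponentials has logarithmic
    derivative y + 2 T w, where 2 T w collects the commutators met on moving y1, y2 and y3 to the
    left. Hence it is exp (T y) exp (T^2 w), and T = 1 gives the claim. *)
Lemma exp4_string :
  exp4 a * exp4 y0 * exp4 (- a)
    = exp4 y0 * exp4 y1 * exp4 y2 * exp4 y3 * exp4 (- w).
Proof.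
pose y := y0 + y1 + y2 + y3.
have [r4 ->]: y ^+ 4 = 0 /\ exp4 a * exp4 y0 * exp4 (- a) = exp4 y.
  apply: exp4_conj => //.
  (* [r] is exp (T ad a) y0. *)
  pose r := Poly [:: y0; y1; y2; y3].
  have: exp4T a * y0%:P = r * exp4T a.
    apply: exp4T_conj; rewrite // ?coef_Poly //.
    apply/polyP=> i; rewrite coef_deriv coefB coefCM coefMC !coef_Poly.
    case: i => [|[|[|[|i]]]] //=; rewrite ?ay0 ?ay1 ?ay2 ?ay3 ?mul0rn //.
    by rewrite nth_nil mul0r mulr0 subrr.
  move/(congr1 (horner^~ 1)); rewrite /= !horner1M !exp4T1 hornerC => ->.
  rewrite horner_Poly /= mul0r !mulr1 add0r /y; congr (_ * _).
  by rewrite (addrC y3) (addrC (y2 + y3)) (addrC _ y0) !addrA.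
set e0 := exp4T y0; set e1 := exp4T y1; set e2 := exp4T y2; set e3 := exp4T y3.
pose W0 := (w0 *+ 2)%:P * 'X; pose W1 := (w1 *+ 2)%:P * 'X; pose W2 := (w2 *+ 2)%:P * 'X.
have comm_exp b c : b ^+ 4 = 0 -> GRing.comm b c -> exp4T b * c%:P = c%:P * exp4T b.
  move=> b4 cbc; apply: exp4T_conj; rewrite ?coefC ?derivC // -!polyCM -polyCB.
  by rewrite cbc subrr.
have shift b c d : b ^+ 4 = 0 -> b * c - c * b = d *+ 2 -> GRing.comm b d ->
    exp4T b * c%:P = (c%:P + (d *+ 2)%:P * 'X) * exp4T b.
  move=> b4 bc bd; apply: exp4T_conj => //.
    rewrite derivD derivC add0r deriv_mulC derivX mulr1; apply/polyP=> i.
    rewrite !(coefB, coefCM, coefMC, coefD, coefC, coefX).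
    case: i => [|[|i]] /=; rewrite ?(mulr0, addr0, mulr1, add0r, mul0r, oppr0) //.
    by rewrite (commrMn 2 bd) subrr.
  by rewrite coefD coefC /= coefCM coefX mulr0 addr0.
have e0y1 : e0 * y1%:P = (y1%:P + W0) * e0 by apply: shift.
have e0y3 : e0 * y3%:P = (y3%:P + W1) * e0 by apply: shift.
have e1y2 : e1 * y2%:P = (y2%:P + W2) * e1 by apply: shift.
have e0W2 : e0 * W2 = W2 * e0.
  rewrite /W2 mulrA comm_exp //; last exact: commrMn.
  by rewrite -!mulrA commr_polyX.
have dv : (e0 * e1 * e2 * e3)^`()
    = (y%:P + (w *+ 2)%:P * 'X) * (e0 * e1 * e2 * e3).
  rewrite !derivM !deriv_exp4T // -/e0 -/e1 -/e2 -/e3.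
  have -> : e0 * (y1%:P * e1) = (y1%:P + W0) * (e0 * e1).
    by rewrite mulrA e0y1 mulrA.
  have -> : e0 * e1 * (y2%:P * e2) = (y2%:P + W2) * (e0 * e1 * e2).
    by rewrite !mulrA -(mulrA e0) e1y2 mulrA mulrDr comm_exp // e0W2 -mulrDl ?mulrA.
  have -> : e0 * e1 * e2 * (y3%:P * e3) = (y3%:P + W1) * (e0 * e1 * e2 * e3).
    rewrite mulrA -[_ * e2 * _]mulrA [e2 * _]comm_exp // mulrA -[_ * e1 * _]mulrA.
    by rewrite [e1 * _]comm_exp // !mulrA e0y3.
  rewrite !mulrA -!mulrDl; congr (_ * _ * _ * _ * _).
  have -> : (w *+ 2)%:P * 'X = W0 + (W1 + W2).
    by rewrite /w -addrA !mulrnDl (polyCD (w0 *+ 2)) mulrDl (polyCD (w1 *+ 2)) mulrDl.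
  rewrite /y !polyCD -!addrA; do 2!congr (_ + _).
  by rewrite addrCA; congr (_ + _); rewrite [RHS]addrCA; congr (_ + _); rewrite addrC -addrA.
have cvw : e0 * e1 * e2 * e3 * ((w *+ 2)%:P * 'X)
    = (w *+ 2)%:P * 'X * (e0 * e1 * e2 * e3).
  have cw b : GRing.comm b w0 -> GRing.comm b w1 ->
      GRing.comm b w2 -> GRing.comm b (w *+ 2).
    by move=> *; apply/commrMn/commrD => //; apply: commrD.
  rewrite -[RHS]mulrA -commr_polyX !mulrA; congr (_ * 'X).
  rewrite -(mulrA _ e3) (comm_exp _ _ y34 (cw _ cw03 cw13 cw23)) mulrA.
  rewrite -(mulrA _ e2) (comm_exp _ _ y24 (cw _ cw02 cw12 cw22)) mulrA.
  rewrite -(mulrA _ e1) (comm_exp _ _ y14 (cw _ cw01 cw11 cw21)) mulrA.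
  by rewrite (comm_exp _ _ y04 (cw _ cw00 cw10 cw20)).
have: exp4T y = e0 * e1 * e2 * e3 * exp4T2 (- w).
  apply: (@poly_ode _ _ y%:P); first exact: deriv_exp4T.
    rewrite derivM dv deriv_exp4T2; last by rewrite exprNn w4 mulr0.
    rewrite mulNrn polyCN !mulNr mulrN [X in _ - X]mulrA cvw mulrDl -!mulrA.
    by rewrite mulrDl !mulrA addrK.
  by rewrite !coef0M !exp4T_coef0 coef_poly /= invr1 scale1r !mulr1.
move/(congr1 (horner^~ 1)); rewrite /= !horner1M !exp4T1 => ->; congr (_ * _).
rewrite horner_poly /exp4 !big_ord_recr !big_ord0 /= !expr1n !mulr1.
by rewrite !addr0 !add0r.
Qed.
End StringConjugation.
End Exponential.

(** * Roots *)

(** The largest number of lines joining two nodes of the Dynkin diagram. The assumptions on p amount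
    to saying that p exceeds it. *)
Definition max_bond (Y : exc_type) : nat :=
  match Y with TypeG2 => 3 | TypeF4 => 2 | _ => 1 end.

Definition positive (v : seq int) : bool := all (fun x : int => 0 <= x) v.

Definition shift_root (g d : seq int) (j : nat) : seq int := iter j (vadd g) d.

(* Call-by-value evaluation does not stop early in the boolean connectives, which
   makes the equality test of lists and membership too slow: hence the
   conditionals below. *)
Fixpoint eq_list (u v : seq int) : bool :=
  match u, v with
  | x :: u', y :: v' => if x == y then eq_list u' v' else false
  | [::], [::] => true
  | _, _ => false
  end.

Fixpoint in_list (v : seq int) (s : seq (seq int)) : bool :=
  if s is w :: s' then if eq_list v w then true else in_list v s' else false.

Lemma eq_listE u v : eq_list u v = (u == v).
Proof. by elim: u v => [|x u IHu] [|y v] //=; rewrite IHu eqseq_cons; case: eqP. Qed.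

Lemma in_listE v s : in_list v s = (v \in s).
Proof. by elim: s => //= w s IHs; rewrite eq_listE IHs inE; case: eqP. Qed.

Definition string_len (s : seq (seq int)) (g d : seq int) : nat :=
  let ok r := in_list (vadd d (vscale (- r%:Z) g)) s in
  if ok 1%N then if ok 2%N then if ok 3%N then 3 else 2 else if ok 3%N then 3 else 1
  else if ok 2%N then if ok 3%N then 3 else 2 else if ok 3%N then 3 else 0.

(* As |N g (v j)| = l j, the divisibilities make (ad e_g)^j / j! integral on the
   string; the bound on l 0 makes N g d invertible in the field when d is positive. *)
Definition string_ok (Y : exc_type) (s : seq (seq int)) (g d : seq int) : bool :=
  let v := shift_root g d in
  let l j := (string_len s g (v j)).+1 in
  let ng := vscale (-1) g in
  if eq_list d ng then true else if ~~ in_list (v 1%N) s then true else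
  if eq_list (v 1%N) ng then false else
  let l0 := l 0%N in
  if positive d && (max_bond Y < l0)%N then false else
  if ~~ in_list (v 2%N) s then ~~ in_list (v 3%N) s else
  if eq_list (v 2%N) ng then false else
  let l1 := l 1%N in
  if ~~ (2 %| l0 * l1)%N then false else
  if ~~ in_list (v 3%N) s then true else
  if eq_list (v 3%N) ng then false else
  if ~~ (6 %| l0 * l1 * l 2%N)%N then false else ~~ in_list (v 4%N) s.

Definition nonroot_sum (s : seq (seq int)) (u v : seq int) : bool :=
  if in_list u s then if in_list v s then ~~ in_list (vadd u v) s else true
  else true.

(** Outside type G2 the test succeeds only if [z] is not a root. Thus halves of structure constants
    can enter the commutator relation in type G2 alone, where 2 is invertible. *)
Definition string_central (Y : exc_type) (s : seq (seq int)) (g d z : seq int) : bool :=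
  if in_list z s then
    if Y is TypeG2 then
      all (fun j => nonroot_sum s (shift_root g d j) z) (iota 0 4)
    else false
  else true.

(* z1 = v 0 + v 1 and z3 = v 0 + v 3 = v 1 + v 2 are the only sums of two members
   of the string v j that may be roots, they occur in type G2 only, one at a time,
   and then they are central: so the string of d generates a group of class 2.  For
   each pair of positive roots this holds in at least one of the two orders. *)
Definition string_class2 (Y : exc_type) (s : seq (seq int)) (g d : seq int) : bool :=
  let v := shift_root g d in
  let z1 := vadd d (v 1%N) in let z3 := vadd d (v 3%N) in
  [&& nonroot_sum s d (v 2%N), nonroot_sum s (v 1%N) (v 3%N), nonroot_sum s (v 2%N) (v 3%N),
      string_central Y s g d z1, string_central Y s g d z3
    & if in_list z1 s then ~~ in_list z3 s else true].

(** The first condition provides a simple coroot that x_g(t) moves by an invertible multiple of t.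
    The second says that the pairing of g with its coroot is 2, the coroot being expanded in the
    simple ones. *)
Definition root_ok (Y : exc_type) (g : seq int) : bool :=
  [&& has (fun i => let c := `|cartan_int Y g i|%N in
                    (0 < c)%N && (c <= max_bond Y)%N) (iota 0 (rank Y))
    & foldr +%R 0 [seq (g`_i * simple_form Y i i %/ lattice_form Y g g)%Z
                        * cartan_int Y g i | i <- iota 0 (rank Y)] == 2].

Definition roots_check (Y : exc_type) (s : seq (seq int)) : bool :=
  all (fun g => (size g == rank Y) && (foldr +%R 0 g != 0)) s &&
  let sp := filter positive s in
  all (fun g => [&& root_ok Y g, all (string_ok Y s g) s &
         all (fun d => if string_class2 Y s g d then true
                       else string_class2 Y s d g) sp]) sp.

Lemma roots_checkP (Y : exc_type) : roots_check Y (roots Y).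
Proof. by case: Y; vm_compute. Qed.

Opaque roots.
Arguments string_len : simpl never.
Arguments shift_root : simpl never.

Lemma vadd_cons x y u v : vadd (x :: u) (y :: v) = (x + y) :: vadd u v.
Proof. by []. Qed.

Lemma vaddC u v : vadd u v = vadd v u.
Proof. by elim: u v => [|x u IHu] [|y v] //; rewrite !vadd_cons addrC IHu. Qed.

Lemma vaddA u v w : vadd u (vadd v w) = vadd (vadd u v) w.
Proof.
by elim: u v w => [|x u IHu] [|y v] [|z w] //; rewrite !vadd_cons addrA IHu.
Qed.

Lemma vaddCA u v w : vadd u (vadd v w) = vadd v (vadd u w).
Proof. by rewrite !vaddA (vaddC u). Qed.

Definition height (v : seq int) : int := foldr +%R 0 v.

Lemma height_vadd u v : size u = size v -> height (vadd u v) = height u + height v.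
Proof.
elim: u v => [|x u IHu] [|y v] // [/IHu IH].
by rewrite vadd_cons /height /= -!/(height _) IH addrACA.
Qed.

Lemma positive_vadd u v : positive u -> positive v -> positive (vadd u v).
Proof.
elim: u v => [|x u IHu] [|y v] // /andP[x0 u0] /andP[y0 v0].
by rewrite vadd_cons /= addr_ge0 //; apply: IHu.
Qed.

Lemma height_ge0 u : positive u -> 0 <= height u.
Proof. by elim: u => //= x u IHu /andP[x0 /IHu]; apply: addr_ge0. Qed.

Lemma string_centralP Y s g d z :
    string_central Y s g d z -> z \in s ->
  Y = TypeG2 /\ all (fun j => nonroot_sum s (shift_root g d j) z) (iota 0 4).
Proof. by rewrite /string_central in_listE => + zs; rewrite zs; case: Y. Qed.

(* Locking keeps the prover from unfolding the computation of the roots. *)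
Definition root_seq (Y : exc_type) : seq (seq int) := locked (roots Y).

Section RootFacts.

Variable Y : exc_type.
Implicit Types g d e : rootT Y.

Lemma posrootsE g : (g \in posroots Y) = positive (val g).
Proof. by rewrite inE. Qed.

Lemma roots_val g : val g \in root_seq Y.
Proof. by rewrite /root_seq -lock; apply: ssvalP. Qed.
Hint Resolve roots_val : core.

Lemma root_seqP v : v \in root_seq Y -> exists e, val e = v.
Proof. by rewrite /root_seq -lock => vY; exists (SeqSub vY). Qed.

Let root_seq_check : roots_check Y (root_seq Y).
Proof. by rewrite /root_seq -lock; apply: roots_checkP. Qed.

Lemma size_root g : size (val g) = rank Y.
Proof. by case/andP: root_seq_check => /allP/(_ _ (roots_val g))/andP[/eqP]. Qed.

Lemma height_root_neq0 g : height (val g) != 0.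
Proof. by case/andP: root_seq_check => /allP/(_ _ (roots_val g))/andP[]. Qed.

Lemma height_posroot g : g \in posroots Y -> 0 < height (val g).
Proof. by rewrite posrootsE lt_def height_root_neq0; apply: height_ge0. Qed.

Lemma height_sum g d e : is_sum g d e -> height (val e) = height (val g) + height (val d).
Proof. by rewrite /is_sum => /eqP->; rewrite height_vadd ?size_root. Qed.

Lemma posroots_sum g d e :
  is_sum g d e -> g \in posroots Y -> d \in posroots Y -> e \in posroots Y.
Proof. by rewrite /is_sum !posrootsE => /eqP->; apply: positive_vadd. Qed.

Lemma is_sumC g d e : is_sum g d e = is_sum d g e.
Proof. by rewrite /is_sum vaddC. Qed.

Let check_pos g : g \in posroots Y ->
  [/\ root_ok Y (val g), forall d, string_ok Y (root_seq Y) (val g) (val d)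
    & forall d, d \in posroots Y ->
        string_class2 Y (root_seq Y) (val g) (val d)
          || string_class2 Y (root_seq Y) (val d) (val g)].
Proof.
have posF e : e \in posroots Y -> val e \in [seq v <- root_seq Y | positive v].
  by rewrite mem_filter posrootsE roots_val andbT.
case/andP: root_seq_check => _ /allP chk /posF/chk/and3P[ok /allP str /allP cl].
split; [exact: ok | by move=> d; apply: str (roots_val d) | move=> d /posF/cl].
by case: (string_class2 _ _ _ _).
Qed.

Lemma cartan_int_bond g : g \in posroots Y ->
  exists2 i : 'I_(rank Y), (0 < `|cartan_int Y (val g) i|)%N
                         & (`|cartan_int Y (val g) i| <= max_bond Y)%N.
Proof.
case/check_pos=> /andP[/hasP[i]]; rewrite mem_iota => lt_i /andP[c0 cm] _ _ _.
by exists (Ordinal lt_i).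
Qed.

Lemma coroot_cartan g : g \in posroots Y ->
  \sum_(i < rank Y) ((val g)`_i * simple_form Y i i
                       %/ lattice_form Y (val g) (val g))%Z
                    * cartan_int Y (val g) i = 2.
Proof.
case/check_pos=> /andP[_ /eqP eq2] _ _; rewrite -{}[RHS]eq2.
by rewrite foldrE big_map -val_enum_ord big_map big_enum.
Qed.

Lemma string_class2_or g d : g \in posroots Y -> d \in posroots Y ->
  string_class2 Y (root_seq Y) (val g) (val d) || string_class2 Y (root_seq Y) (val d) (val g).
Proof. by case/check_pos=> _ _; apply. Qed.

Lemma string_downE g d : string_down g d = string_len (root_seq Y) (val g) (val d).
Proof.
rewrite /root_seq -lock /string_down big_mkcond !big_ord_recr big_ord0 /= /string_len !in_listE.
by do 4!case: ifP.
Qed.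

Lemma string_okP g d (v := shift_root (val g) (val d))
    (l := fun j => (string_len (root_seq Y) (val g) (v j)).+1)
    (ng := vscale (-1) (val g)) :
    g \in posroots Y -> val d != ng -> v 1%N \in root_seq Y ->
  [/\ v 1%N != ng, d \in posroots Y -> (l 0%N <= max_bond Y)%N,
      v 2%N \in root_seq Y -> v 2%N != ng /\ (2 %| l 0%N * l 1%N)%N &
      v 2%N \in root_seq Y -> v 3%N \in root_seq Y ->
        [/\ v 3%N != ng, (6 %| l 0%N * l 1%N * l 2%N)%N & v 4%N \notin root_seq Y]].
Proof.
move=> /check_pos[_ /(_ d) + _] /negPf nd v1.
rewrite /string_ok -/ng -/v !eq_listE !in_listE nd v1 posrootsE [(max_bond Y < _)%N]ltnNge.
rewrite /l.
(* With every test replaced by an arbitrary boolean, the claim is a propositional consequence of the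
   nested conditionals. *)
move: (v 1%N == ng) (v 2%N == ng) (v 3%N == ng) (v 2%N \in _) (v 3%N \in _) (v 4%N \in _).
move: (2 %| _)%N (6 %| _)%N (positive _) (_ <= max_bond Y)%N.
move=> {nd v1 l v ng} b1 b2 b3 b4 b5 b6 b7 b8 b9 b10.
by case: b5 b3 b6 b1 b2 b4 b7 b9 b10 b8; do 9!(case=> //=); split.
Qed.

Lemma string_class2P g d (v := shift_root (val g) (val d))
    (s := root_seq Y) (z1 := vadd (val d) (v 1%N)) (z3 := vadd (val d) (v 3%N)) :
    string_class2 Y s (val g) (val d) ->
  [/\ v 2%N \in s -> vadd (val d) (v 2%N) \notin s,
      v 1%N \in s -> v 3%N \in s -> vadd (v 1%N) (v 3%N) \notin s,
      v 2%N \in s -> v 3%N \in s -> vadd (v 2%N) (v 3%N) \notin s,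
      forall z, z = z1 \/ z = z3 -> z \in s ->
        Y = TypeG2 /\ forall j, (j < 4)%N -> v j \in s -> vadd (v j) z \notin s &
      z1 \in s -> z3 \notin s].
Proof.
rewrite /string_class2 -/v -/z1 -/z3 !in_listE -/s.
move=> /and5P[c02 c13 c23 c1 /andP[c3 c13']].
have nsum u u' : nonroot_sum s u u' -> u \in s -> u' \in s -> vadd u u' \notin s.
  by rewrite /nonroot_sum !in_listE => + us u's; rewrite us u's.
have central z : string_central Y s (val g) (val d) z -> z \in s ->
    Y = TypeG2 /\ forall j, (j < 4)%N -> v j \in s -> vadd (v j) z \notin s.
  move=> /string_centralP cz zs; have [YG2 /allP all4] := cz zs.
  by split; [exact: YG2 | move=> j lt_j vj; apply: nsum (all4 j _) vj zs; rewrite mem_iota].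
split.
- exact: nsum c02 (roots_val d).
- exact: nsum c13.
- exact: nsum c23.
- by move=> z [] ->; [apply: (central _ c1) | apply: (central _ c3)].
by move=> z1s; move: c13'; rewrite z1s.
Qed.

End RootFacts.

(** * The adjoint representation *)

Section LieMatrices.

Variable Y : exc_type.
Local Notation I := (chev_index Y).
Local Notation n := #|I|.-1.

(** The ring structure on square matrices requires a size of the form [n.+1]. *)
Lemma card_chev_index : n.+1 = #|I|.
Proof.
rewrite prednK //; apply/card_gt0P.
have i : 'I_(rank Y) by apply: (@Ordinal _ 0); case: Y.
by exists (inl i).
Qed.

Definition chev_idx (i : 'I_n.+1) : I := enum_val (cast_ord card_chev_index i).
Definition chev_rank (b : I) : 'I_n.+1 := cast_ord (esym card_chev_index) (enum_rank b).

Lemma chev_idxK : cancel chev_idx chev_rank.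
Proof. by move=> i; rewrite /chev_rank enum_valK cast_ordK. Qed.

Lemma chev_rankK : cancel chev_rank chev_idx.
Proof. by move=> b; rewrite /chev_idx cast_ordKV enum_rankK. Qed.

Lemma sum_chev_idx (V : nmodType) (f : I -> V) : \sum_i f (chev_idx i) = \sum_b f b.
Proof.
rewrite [RHS](reindex chev_idx) //; exists chev_rank => b _.
  exact: chev_idxK.
exact: chev_rankK.
Qed.

Section MatrixOf.
Variable R : pzSemiRingType.

Definition mx_of (f : I -> I -> R) : 'M[R]_n.+1 :=
  \matrix_(i, j) f (chev_idx i) (chev_idx j).

Definition row_of (u : I -> R) : 'rV[R]_n.+1 := \row_j u (chev_idx j).

Lemma eq_mx_of f f' : (forall b c, f b c = f' b c) -> mx_of f = mx_of f'.
Proof. by move=> eq_f; apply/matrixP=> i j; rewrite !mxE. Qed.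

Lemma row_of_inj u u' : row_of u = row_of u' -> u =1 u'.
Proof.
by move=> /rowP eq_u b; have := eq_u (chev_rank b); rewrite !mxE chev_rankK.
Qed.

Lemma mx_ofM f f' : mx_of f *m mx_of f' = mx_of (fun b c => \sum_e f b e * f' e c).
Proof.
apply/matrixP=> i j; rewrite !mxE -sum_chev_idx.
by apply: eq_bigr => k _; rewrite !mxE.
Qed.

Lemma row_ofM u f : row_of u *m mx_of f = row_of (fun c => \sum_b u b * f b c).
Proof.
apply/rowP=> j; rewrite !mxE -sum_chev_idx.
by apply: eq_bigr => k _; rewrite !mxE.
Qed.

End MatrixOf.

Variable N : rootT Y -> rootT Y -> int.
Local Notation lieZ := {ffun I -> int}.
Local Notation bb := (basis_bracket N).
Local Notation bracket := (bracket N).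
Local Notation basis_vec := (@basis_vec Y).

Lemma bracketE u v e : bracket u v e = \sum_b \sum_c bb b c e * (u b * v c).
Proof.
rewrite /Defs.bracket sum_ffunE; apply: eq_bigr => b _.
by rewrite sum_ffunE; apply: eq_bigr => c _; rewrite ffunMzE mulrzz.
Qed.

Lemma sum_basis_vec (x : I) (f : I -> int) : \sum_b f b * basis_vec x b = f x.
Proof.
rewrite (bigD1 x) //= ffunE eqxx mulr1 big1 ?addr0 // => b /negPf nbx.
by rewrite ffunE nbx mulr0.
Qed.

Lemma bracketDl u u' v : bracket (u + u') v = bracket u v + bracket u' v.
Proof.
apply/ffunP=> e; rewrite ffunE !bracketE -big_split /=; apply: eq_bigr => b _.
by rewrite -big_split /=; apply: eq_bigr => c _; rewrite ffunE; ring.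
Qed.

Lemma bracketDr u v v' : bracket u (v + v') = bracket u v + bracket u v'.
Proof.
apply/ffunP=> e; rewrite ffunE !bracketE -big_split /=; apply: eq_bigr => b _.
by rewrite -big_split /=; apply: eq_bigr => c _; rewrite ffunE; ring.
Qed.

Lemma bracketMzl u v z : bracket (u *~ z) v = bracket u v *~ z.
Proof.
apply/ffunP=> e; rewrite ffunMzE mulrzz !bracketE mulr_suml; apply: eq_bigr => b _.
by rewrite mulr_suml; apply: eq_bigr => c _; rewrite ffunMzE mulrzz; ring.
Qed.

Lemma bracketMzr u v z : bracket u (v *~ z) = bracket u v *~ z.
Proof.
apply/ffunP=> e; rewrite ffunMzE mulrzz !bracketE mulr_suml; apply: eq_bigr => b _.
by rewrite mulr_suml; apply: eq_bigr => c _; rewrite ffunMzE mulrzz; ring.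
Qed.

Lemma bracket0r u : bracket u 0 = 0.
Proof. by rewrite -(mulr0z (0 : lieZ)) bracketMzr mulr0z. Qed.

Lemma bracket0l v : bracket 0 v = 0.
Proof. by rewrite -(mulr0z (0 : lieZ)) bracketMzl mulr0z. Qed.

Lemma bracket_sumr (J : Type) (r : seq J) P (f : J -> lieZ) u :
  bracket u (\sum_(j <- r | P j) f j) = \sum_(j <- r | P j) bracket u (f j).
Proof. by apply: (big_morph (bracket u)) => [v v'|]; rewrite ?bracketDr ?bracket0r. Qed.

Lemma bracket_basis x y : bracket (basis_vec x) (basis_vec y) = bb x y.
Proof.
apply/ffunP=> e; rewrite bracketE -[RHS](sum_basis_vec x (fun b => bb b y e)).
apply: eq_bigr => b _; rewrite -[RHS](sum_basis_vec y (fun c => bb b c e * _)).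
by apply: eq_bigr => c _; ring.
Qed.

Lemma basis_vec_sum (v : lieZ) : v = \sum_b basis_vec b *~ v b.
Proof.
apply/ffunP=> e; rewrite sum_ffunE -[LHS](sum_basis_vec e v).
by apply: eq_bigr => b _; rewrite ffunMzE mulrzz !ffunE eq_sym mulrC.
Qed.

Hypothesis hN : chevalley_constants N.

Lemma bracket_anti u v : bracket u v = - bracket v u.
Proof.
have [alt _ _] := hN; apply/eqP; rewrite -addr_eq0; apply/eqP.
by have := alt (u + v); rewrite bracketDl !bracketDr !alt add0r addr0.
Qed.

Lemma bracket_jacobi u v w :
  bracket (bracket u v) w = bracket u (bracket v w) - bracket v (bracket u w).
Proof.
have [_ jac _] := hN; have /eqP := jac u v w.
rewrite (bracket_anti w (bracket u v)) (bracket_anti w u) subr_eq0 => /eqP <-.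
by rewrite -[- bracket u w](mulrN1z (bracket u w)) bracketMzr mulrN1z.
Qed.

Definition ad_mx (u : lieZ) : 'M[int]_n.+1 := mx_of (fun b c => bracket u (basis_vec b) c).

(** Matrices act on rows, so their product is composition in the opposite order; this reverses the
    commutator. *)
Lemma ad_mx_bracket u v :
  ad_mx (bracket u v) = ad_mx v * ad_mx u - ad_mx u * ad_mx v.
Proof.
have adM u1 u2 : ad_mx u2 * ad_mx u1 = mx_of (fun b c => bracket u1 (bracket u2 (basis_vec b)) c).
  rewrite -mulmxE mx_ofM; apply: eq_mx_of => b c.
  rewrite [in RHS](basis_vec_sum (bracket u2 _)) bracket_sumr sum_ffunE.
  by apply: eq_bigr => e _; rewrite bracketMzr ffunMzE mulrzz mulrC.
rewrite !adM; apply/matrixP=> i j; rewrite !mxE bracket_jacobi !ffunE //.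
Qed.
End LieMatrices.

Lemma shift_root0 g d : shift_root g d 0 = d. Proof. by []. Qed.

Lemma shift_rootS g d j : shift_root g d j.+1 = vadd g (shift_root g d j).
Proof. by []. Qed.

Section RootStrings.

Variable Y : exc_type.
Implicit Types g d e : rootT Y.

Section SumRoot.
Variables (V : nmodType) (f : rootT Y -> V).

(** Extends [f] by 0 to the lattice elements that are not roots, so that identities along a string
    also hold past its end. *)
Definition sum_root (v : seq int) : V := \sum_(e | val e == v) f e.

Lemma sum_rootE e : sum_root (val e) = f e.
Proof. by rewrite /sum_root (big_pred1 e) // => e'; rewrite val_eqE. Qed.

Lemma sum_root_out v : v \notin root_seq Y -> sum_root v = 0.
Proof.
move=> vY; rewrite /sum_root; apply: big_pred0 => e.
by apply: contraNF vY => /eqP <-; apply: roots_val.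
Qed.

End SumRoot.

Lemma root_ind (P : seq int -> Prop) v :
  (forall e, P (val e)) -> (v \notin root_seq Y -> P v) -> P v.
Proof.
move=> Pr Pn; have [vY | ] := boolP (v \in root_seq Y); last exact: Pn.
by have [e <-] := root_seqP vY.
Qed.

Variable N : rootT Y -> rootT Y -> int.
Hypothesis hN : chevalley_constants N.
Local Notation I := (chev_index Y).
Local Notation lieZ := {ffun I -> int}.
Local Notation bracket := (bracket N).
Local Notation basis_vec := (@basis_vec Y).
Local Notation e_ g := (basis_vec (inr g)).

Definition root_vec : seq int -> lieZ := sum_root (fun e => e_ e).

Lemma root_vec_val e : root_vec (val e) = e_ e.
Proof. exact: sum_rootE. Qed.

Lemma root_vec_out v : v \notin root_seq Y -> root_vec v = 0.
Proof. exact: sum_root_out. Qed.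

Lemma bracket_root_vec g v : v != vscale (-1) (val g) ->
  bracket (e_ g) (root_vec v) = root_vec (vadd (val g) v) *~ sum_root (N g) v.
Proof.
pose P u := u != vscale (-1) (val g) ->
  bracket (e_ g) (root_vec u) = root_vec (vadd (val g) u) *~ sum_root (N g) u.
apply: (@root_ind P) => [d /negPf nd | vY _]; last first.
  by rewrite root_vec_out // bracket0r sum_root_out // mulr0z.
rewrite root_vec_val sum_rootE bracket_basis /basis_bracket nd -/(vadd _ _).
by rewrite /root_vec /sum_root mulrz_suml; apply: eq_bigl => e; rewrite /is_sum.
Qed.

Definition string_prod g d j : int :=
  \prod_(k < j) sum_root (N g) (shift_root (val g) (val d) k).

Lemma string_prodS g d j :
  string_prod g d j.+1 = string_prod g d j * sum_root (N g) (shift_root (val g) (val d) j).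
Proof. exact: big_ord_recr. Qed.

(** At -g the bracket with e_g is a coroot and not a multiple of a root vector. The hypothesis asks
    that the coefficient has become 0 by the time the string arrives there. *)
Lemma iter_bracket_root g d j :
    (forall k, (k < j)%N -> shift_root (val g) (val d) k \in root_seq Y ->
       shift_root (val g) (val d) k = vscale (-1) (val g) ->
       string_prod g d k = 0) ->
  iter j (bracket (e_ g)) (e_ d) = root_vec (shift_root (val g) (val d) j) *~ string_prod g d j.
Proof.
elim: j => [|j IHj] nneg.
  by rewrite /string_prod big_ord0 shift_root0 root_vec_val mulr1z.
rewrite iterS IHj => [|k lt_kj]; last by apply: nneg; rewrite ltnS ltnW.
rewrite bracketMzr string_prodS shift_rootS.
have [jY | jY] := boolP (shift_root (val g) (val d) j \in root_seq Y); last first.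
  by rewrite (root_vec_out jY) bracket0r (sum_root_out _ jY) mulr0 mul0rz mulr0z.
have [eq_neg | neq_neg] := eqVneq (shift_root (val g) (val d) j) (vscale (-1) (val g)).
  by rewrite nneg // mul0r !mulr0z.
by rewrite bracket_root_vec // [in RHS]mulrC mulrzA.
Qed.

Lemma abs_string_const g v :
    v \in root_seq Y -> vadd (val g) v \in root_seq Y ->
  `|sum_root (N g) v|%N = (string_len (root_seq Y) (val g) v).+1.
Proof.
move=> /root_seqP[d <-] /root_seqP[e e_gd].
have [_ _ hl] := hN; rewrite sum_rootE -string_downE.
by apply: (hl _ _ e); rewrite /is_sum e_gd.
Qed.

Lemma string_prod1 g d : string_prod g d 1 = N g d.
Proof. by rewrite string_prodS shift_root0 sum_rootE /string_prod big_ord0 mul1r. Qed.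

Lemma string_prod_stop g d i j :
  shift_root (val g) (val d) i \notin root_seq Y -> (i < j)%N -> string_prod g d j = 0.
Proof.
move=> vi lt_ij; rewrite /string_prod (bigD1 (Ordinal lt_ij)) //=.
by rewrite sum_root_out // mul0r.
Qed.

Section PositiveString.

Variables g d : rootT Y.
Hypotheses (g_pos : g \in posroots Y) (dNg : val d != vscale (-1) (val g)).
Local Notation v := (shift_root (val g) (val d)).

(** By the check on strings, -g could only be reached across a gap in the string, and a gap puts a
    zero factor into the product. *)
Lemma string_not_neg k :
    (k < 4)%N -> v k \in root_seq Y -> v k = vscale (-1) (val g) ->
  string_prod g d k = 0.
Proof.
case: k => [_ _ v0|k lt_k vk eq_k]; first by case/eqP: dNg; rewrite -v0.
have [v1 | v1] := boolP (v 1 \in root_seq Y); last first.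
  case: k lt_k vk eq_k => [_ vk|k _ _ _]; first by rewrite vk in v1.
  exact: string_prod_stop v1 _.
have [nv1 _ ok2 ok3] := string_okP g_pos dNg v1.
case: k lt_k vk eq_k => [_ _ eq_k|[|[|//]] _ vk eq_k]; first by rewrite eq_k eqxx in nv1.
  by have [] := ok2 vk; rewrite eq_k eqxx.
have [v2 | v2] := boolP (v 2 \in root_seq Y); last exact: string_prod_stop v2 _.
by have [] := ok3 v2 vk; rewrite eq_k eqxx.
Qed.

Lemma string_prod_dvd j : (j < 4)%N -> v j \in root_seq Y -> (j`!%:Z %| string_prod g d j)%Z.
Proof.
case: j => [|[|j]] lt_j vj; try exact: dvd1z.
have [v1 | v1] := boolP (v 1 \in root_seq Y); last first.
  by rewrite (string_prod_stop v1) // dvdz0.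
have v0 : v 0 \in root_seq Y := roots_val d.
have [_ _ ok2 ok3] := string_okP g_pos dNg v1.
case: j lt_j vj => [|[|//]] _ vj.
  have [_ dv] := ok2 vj.
  rewrite !string_prodS /string_prod big_ord0 mul1r dvdzE abszM.
  by rewrite (abs_string_const v0 v1) (abs_string_const v1 vj).
have [v2 | v2] := boolP (v 2 \in root_seq Y); last first.
  by rewrite (string_prod_stop v2) // dvdz0.
have [_ dv _] := ok3 v2 vj.
rewrite !string_prodS /string_prod big_ord0 mul1r dvdzE !abszM.
by rewrite (abs_string_const v0 v1) (abs_string_const v1 v2) (abs_string_const v2 vj).
Qed.

Lemma string_prod4 : v 4 \in root_seq Y -> string_prod g d 4 = 0.
Proof.
move=> v4.
have [v1 | v1] := boolP (v 1 \in root_seq Y); last exact: string_prod_stop v1 _.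
have [v2 | v2] := boolP (v 2 \in root_seq Y); last exact: string_prod_stop v2 _.
have [v3 | v3] := boolP (v 3 \in root_seq Y); last exact: string_prod_stop v3 _.
have [_ _ _ ok3] := string_okP g_pos dNg v1.
by have [_ _] := ok3 v2 v3; rewrite v4.
Qed.

End PositiveString.
End RootStrings.

Lemma height_neg v : height (vscale (-1) v) = - height v.
Proof.
elim: v => [|x v IHv]; first by rewrite oppr0.
by rewrite /height /= -/(height _) -/(height v) IHv mulN1r opprD.
Qed.

(** * Integrality and nilpotency of the adjoint action *)

Section DividedPowers.

Variable Y : exc_type.
Implicit Types g d e : rootT Y.
Variable N : rootT Y -> rootT Y -> int.
Hypothesis hN : chevalley_constants N.
Local Notation I := (chev_index Y).
Local Notation n := #|I|.-1.
Local Notation lieZ := {ffun I -> int}.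
Local Notation bracket := (bracket N).
Local Notation basis_vec := (@basis_vec Y).
Local Notation e_ g := (basis_vec (inr g)).
Local Notation root_vec := (@root_vec Y).

Lemma pos_neq_neg g v : g \in posroots Y -> positive v -> v != vscale (-1) (val g).
Proof.
move=> g_pos v_pos; apply: contraL (height_ge0 v_pos) => /eqP->.
by rewrite height_neg oppr_ge0 -ltNge height_posroot.
Qed.

Lemma bracket_alt u : bracket u u = 0. Proof. by have [] := hN. Qed.

Lemma iter_bracket0 j u : iter j (bracket u) 0 = 0.
Proof. by elim: j => //= j ->; rewrite bracket0r. Qed.

Lemma bracket_basis_cartan g i :
  bracket (e_ g) (basis_vec (inl i)) = e_ g *~ - cartan_int Y (val g) i.
Proof. by rewrite bracket_basis mulrNz. Qed.

Lemma bracket_neg g d : val d = vscale (-1) (val g) -> bracket (e_ g) (e_ d) = coroot_vec g.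
Proof. by move=> d_neg; rewrite bracket_basis /= d_neg eqxx. Qed.

Lemma bracket_coroot g : g \in posroots Y -> bracket (e_ g) (coroot_vec g) = e_ g *~ - 2.
Proof.
move=> /coroot_cartan <-; rewrite bracket_sumr -sumrN mulrz_sumr.
apply: eq_bigr => i _; rewrite bracketMzr bracket_basis_cartan -mulrzA.
by rewrite mulNr mulrC.
Qed.

(** For the powers from the second on: a Cartan element is sent to 0; e_(-g) goes to -2 e_g and then
    to 0; any other root vector follows its string, whose products have the required
    divisibility. *)
Lemma iter_bracket_dvd g b c i : g \in posroots Y -> (i < 4)%N ->
  (i`!%:Z %| iter i (bracket (e_ g)) (basis_vec b) c)%Z.
Proof.
move=> g_pos lt_i; case: i lt_i => [|[|i]] lt_i; try exact: dvd1z.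
case: b => [k | d].
  by rewrite !iterSr bracket_basis_cartan bracketMzr bracket_alt mul0rz iter_bracket0 ffunE dvdz0.
have [d_neg | d_neg] := eqVneq (val d) (vscale (-1) (val g)).
  rewrite !iterSr bracket_neg // bracket_coroot //.
  case: i lt_i => [|i] lt_i; last first.
    by rewrite iterSr bracketMzr bracket_alt mul0rz iter_bracket0 ffunE dvdz0.
  by rewrite ffunMzE mulrzz; apply: dvdz_mull.
rewrite iter_bracket_root => [|k lt_k]; last first.
  by apply: string_not_neg; rewrite ?(leq_trans lt_k (ltnW lt_i)).
have [vY | vY] := boolP (shift_root (val g) (val d) i.+2 \in root_seq Y).
  by rewrite ffunMzE mulrzz; apply/dvdz_mull/string_prod_dvd.
by rewrite root_vec_out // mul0rz ffunE dvdz0.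
Qed.

Lemma iter_bracket4 g b : g \in posroots Y -> iter 4 (bracket (e_ g)) (basis_vec b) = 0.
Proof.
move=> g_pos; case: b => [k | d].
  by rewrite 2!iterSr bracket_basis_cartan bracketMzr bracket_alt mul0rz iter_bracket0.
have [d_neg | d_neg] := eqVneq (val d) (vscale (-1) (val g)).
  by rewrite 3!iterSr bracket_neg // bracket_coroot // bracketMzr bracket_alt mul0rz iter_bracket0.
rewrite iter_bracket_root => [|k lt_k]; last exact: string_not_neg.
have [vY | vY] := boolP (shift_root (val g) (val d) 4 \in root_seq Y).
  by rewrite string_prod4.
by rewrite root_vec_out // mul0rz.
Qed.

Lemma ad_mx_exp g i :
  ad_mx N (e_ g) ^+ i = mx_of (fun b c => iter i (bracket (e_ g)) (basis_vec b) c).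
Proof.
elim: i => [|i IHi].
  apply/matrixP=> j k; rewrite !mxE ffunE (can_eq (@chev_idxK Y)) eq_sym.
  by case: eqP.
rewrite exprSr IHi -mulmxE mx_ofM; apply: eq_mx_of => b c.
rewrite iterS [in RHS](basis_vec_sum (iter i _ _)) bracket_sumr sum_ffunE.
by apply: eq_bigr => e _; rewrite bracketMzr ffunMzE mulrzz mulrC.
Qed.

Definition divpow_mx g i : 'M[int]_n.+1 := mx_of (fun b c => ad_divpow N g i b c).

Lemma divpow_mxE g i : g \in posroots Y -> (i < 4)%N ->
  ad_mx N (e_ g) ^+ i = (divpow_mx g i) *+ i`!.
Proof.
move=> g_pos lt_i; rewrite ad_mx_exp; apply/matrixP=> j k.
by rewrite mulmxnE !mxE -mulr_natr natz divzK // iter_bracket_dvd.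
Qed.

Lemma ad_mx4 g : g \in posroots Y -> ad_mx N (e_ g) ^+ 4 = 0.
Proof.
by move=> g_pos; rewrite ad_mx_exp; apply/matrixP=> j k; rewrite !mxE iter_bracket4 // ffunE.
Qed.

Lemma ad_mxMz u z : ad_mx N (u *~ z) = z *: ad_mx N u.
Proof. by apply/matrixP=> i j; rewrite !mxE bracketMzl ffunMzE mulrzz mulrC. Qed.

Lemma ad_mx0 : ad_mx N 0 = 0.
Proof. by apply/matrixP=> i j; rewrite !mxE bracket0l ffunE. Qed.

Lemma ad_mx_comm g v : v != vscale (-1) (val g) ->
  ad_mx N (root_vec v) * ad_mx N (e_ g) - ad_mx N (e_ g) * ad_mx N (root_vec v)
    = sum_root (N g) v *: ad_mx N (root_vec (vadd (val g) v)).
Proof. by move=> v_neg; rewrite -ad_mx_bracket // bracket_root_vec // ad_mxMz. Qed.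

End DividedPowers.

(** * Commutator relations *)

Lemma positive_shift_root g d j : positive g -> positive d -> positive (shift_root g d j).
Proof. by move=> pg pd; elim: j => // j IHj; rewrite shift_rootS positive_vadd. Qed.

Lemma map_mx_injective (R S : Type) (f : R -> S) m m' :
  injective f -> injective (map_mx f : 'M_(m, m') -> 'M_(m, m')).
Proof.
move=> f_inj M M' eqM; apply/matrixP=> i j; apply: f_inj.
by move/matrixP/(_ i j): eqM; rewrite !mxE.
Qed.

Section RootMatrices.

Variable Y : exc_type.
Implicit Types g d e : rootT Y.
Variable N : rootT Y -> rootT Y -> int.
Hypothesis hN : chevalley_constants N.
Local Notation I := (chev_index Y).
Local Notation n := #|I|.-1.
Local Notation root_vec := (@root_vec Y).

Lemma prod_root_in (R : pzSemiRingType) (f : rootT Y -> R) e0 :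
  \prod_(e | val e == val e0) f e = f e0.
Proof. by rewrite (big_pred1 e0) // => e; rewrite val_eqE. Qed.

Lemma prod_root_out (R : pzSemiRingType) (f : rootT Y -> R) v :
  v \notin root_seq Y -> \prod_(e | val e == v) f e = 1.
Proof.
move=> vY; apply: big_pred0 => e.
by apply: contraNF vY => /eqP <-; apply: roots_val.
Qed.

(* Both matrices are locked: without this, comparing them for different roots
   unfolds the Lie bracket. *)
Fact root_mx_key : unit. Proof. exact: tt. Qed.

Definition root_mx (R : nzRingType) : rootT Y -> R -> 'M[R]_n.+1 :=
  locked_with root_mx_key
    (fun g t => \sum_(i < 4) t ^+ i *: map_mx intr (divpow_mx N g i)).

Definition vroot_mx (R : nzRingType) : seq int -> R -> 'M[R]_n.+1 :=
  locked_with root_mx_key (fun v t => \prod_(e | val e == v) root_mx e t).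

Lemma root_mx_def (R : nzRingType) g (t : R) :
  root_mx g t = \sum_(i < 4) t ^+ i *: map_mx intr (divpow_mx N g i).
Proof. by rewrite /root_mx locked_withE. Qed.

Lemma vroot_mx_in (R : nzRingType) e (t : R) : vroot_mx (val e) t = root_mx e t.
Proof. by rewrite /vroot_mx locked_withE prod_root_in. Qed.

Lemma vroot_mx_out (R : nzRingType) v (t : R) : v \notin root_seq Y -> vroot_mx v t = 1.
Proof. by move=> vY; rewrite /vroot_mx locked_withE prod_root_out. Qed.

Lemma map_root_mx (R S : comNzRingType) (f : {rmorphism R -> S}) g t :
  map_mx f (root_mx g t) = root_mx g (f t).
Proof.
apply/matrixP=> j k; rewrite !root_mx_def !mxE !summxE rmorph_sum; apply: eq_bigr => i _.
by rewrite !mxE rmorphM rmorphXn /= rmorph_int.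
Qed.

Lemma map_vroot_mx (R S : comNzRingType) (f : {rmorphism R -> S}) v t :
  map_mx f (vroot_mx v t) = vroot_mx v (f t).
Proof.
apply: (@root_ind Y (fun v => map_mx f (vroot_mx v t) = _)) => [e | vY].
  by rewrite !vroot_mx_in map_root_mx.
by rewrite !vroot_mx_out // map_mx1.
Qed.

(* [string_const g d j] is the coefficient of e_(d + j g) in (ad e_g)^j e_d / j! *)
Definition string_const g d j : int := (string_prod N g d j %/ j`!)%Z.

Definition pair_const (u v : seq int) : int := sum_root (fun e => sum_root (N e) v) u.

Section CharZero.

Variable K : fieldType.
Hypothesis natK_neq0 : forall m, m.+1%:R != 0 :> K.

Definition ad_root (v : seq int) : 'M[K]_n.+1 := map_mx intr (ad_mx N (root_vec v)).

Lemma ad_root_out v : v \notin root_seq Y -> ad_root v = 0.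
Proof.
by move=> vY; rewrite /ad_root root_vec_out // ad_mx0 map_mx0.
Qed.

Lemma ad_root4 v : positive v -> ad_root v ^+ 4 = 0.
Proof.
apply: (@root_ind Y (fun v => positive v -> ad_root v ^+ 4 = 0)) => [e | vY _].
  rewrite -posrootsE => e_pos.
  by rewrite /ad_root root_vec_val -rmorphXn /= ad_mx4 ?map_mx0.
by rewrite ad_root_out // expr0n.
Qed.

Lemma ad_rootZ4 v c : positive v -> (c *: ad_root v) ^+ 4 = 0.
Proof. by move=> v_pos; rewrite exprZn ad_root4 ?scaler0. Qed.

Lemma exp4_0 : exp4 (0 : 'M[K]_n.+1) = 1.
Proof.
rewrite /exp4 big_ord_recl big1 => [|i _]; last by rewrite expr0n scaler0.
by rewrite addr0 expr0 invr1 scale1r.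
Qed.

Lemma vroot_mxE v t : positive v -> vroot_mx v t = exp4 (t *: ad_root v).
Proof.
apply: (@root_ind Y (fun v => positive v -> _)) => [e | vY _]; last first.
  by rewrite ad_root_out // scaler0 exp4_0 vroot_mx_out.
rewrite -posrootsE => e_pos; rewrite vroot_mx_in root_mx_def.
apply: eq_bigr => i _; rewrite exprZn scalerA mulrC -scalerA; congr (_ *: _).
rewrite /ad_root root_vec_val -rmorphXn /= divpow_mxE // rmorphMn /=.
rewrite -scaler_nat scalerA mulVf ?scale1r //.
by case: (i`!) (fact_gt0 i) => // m _.
Qed.

Lemma root_mxE g t : g \in posroots Y -> root_mx g t = exp4 (t *: ad_root (val g)).
Proof. by rewrite posrootsE => g_pos; rewrite -vroot_mxE // vroot_mx_in. Qed.

Lemma ad_root_bracket u v : positive u -> positive v ->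
  ad_root v * ad_root u - ad_root u * ad_root v
    = (pair_const u v)%:~R *: ad_root (vadd u v).
Proof.
move=> + v_pos; apply: (@root_ind Y (fun u => positive u -> _)) => [e | uY _]; last first.
  by rewrite (ad_root_out uY) mulr0 mul0r subrr /pair_const sum_root_out // scale0r.
rewrite -posrootsE => e_pos; rewrite /pair_const sum_rootE /ad_root.
rewrite root_vec_val -!rmorphM -rmorphB /=.
rewrite (ad_mx_comm hN (pos_neq_neg e_pos v_pos)).
by apply/matrixP=> i j; rewrite !mxE rmorphM.
Qed.

Lemma comm_ad_root u v : positive u -> positive v ->
    (u \in root_seq Y -> v \in root_seq Y -> vadd u v \notin root_seq Y) ->
  GRing.comm (ad_root u) (ad_root v).
Proof.
move=> u_pos v_pos uv_out; apply/esym/eqP; rewrite -subr_eq0; apply/eqP.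
have [uY | uY] := boolP (u \in root_seq Y); last first.
  by rewrite (ad_root_out uY) mulr0 mul0r subrr.
have [vY | vY] := boolP (v \in root_seq Y); last first.
  by rewrite (ad_root_out vY) mulr0 mul0r subrr.
by rewrite ad_root_bracket // ad_root_out ?scaler0 ?uv_out.
Qed.

Lemma root_mxD_char0 g s t : g \in posroots Y ->
  root_mx g (s + t) = root_mx g s * root_mx g t :> 'M[K]_n.+1.
Proof.
move=> g_pos; have pg : positive (val g) by rewrite -posrootsE.
rewrite !root_mxE // scalerDl exp4D ?ad_rootZ4 //.
- by rewrite -scalerDl ad_rootZ4.
- by rewrite /GRing.comm -!scalerAl -!scalerAr !scalerA mulrC.
Qed.

Section Commutator.

Variables g d : rootT Y.
Hypotheses (g_pos : g \in posroots Y) (d_pos : d \in posroots Y).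
Local Notation v := (shift_root (val g) (val d)).
Local Notation c := (string_const g d).

Let pg : positive (val g). Proof. by rewrite -posrootsE. Qed.
Let pd : positive (val d). Proof. by rewrite -posrootsE. Qed.
Let pv j : positive (v j). Proof. exact: positive_shift_root. Qed.
Let dNg : val d != vscale (-1) (val g). Proof. exact: pos_neq_neg. Qed.

Lemma string_constK j : (j < 4)%N -> v j \in root_seq Y -> c j * j`!%:Z = string_prod N g d j.
Proof. by move=> lt_j vj; rewrite divzK // string_prod_dvd. Qed.

Lemma string_constS j : (j < 3)%N -> v j.+1 \in root_seq Y ->
  c j * sum_root (N g) (v j) = j.+1%:Z * c j.+1.
Proof.
move=> lt_j vS; have [vj | vj] := boolP (v j \in root_seq Y); last first.
  by rewrite sum_root_out // mulr0 /string_const (string_prod_stop _ vj (ltnSn j)) div0z mulr0.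
have := string_prodS N g d j; rewrite -!string_constK ?(ltn_trans lt_j) //.
rewrite factS PoszM => E; have fz : (j`!%:Z != 0) by rewrite -lt0n fact_gt0.
by apply: (mulIf fz); rewrite mulrAC -E; ring.
Qed.

Lemma string_const3 : v 4%N \in root_seq Y -> c 3%N * sum_root (N g) (v 3%N) = 0.
Proof.
move=> v4; have [v3 | v3] := boolP (v 3%N \in root_seq Y); last first.
  by rewrite sum_root_out // mulr0.
have fz : (3`!%:Z != 0) by [].
apply: (mulIf fz); rewrite mulrAC string_constK // -string_prodS mul0r.
exact: string_prod4.
Qed.

Definition string_mx j : 'M[K]_n.+1 := (c j)%:~R *: ad_root (v j).

Lemma string_mx_bracket j : (j < 3)%N ->
  string_mx j * ad_root (val g) - ad_root (val g) * string_mx j = string_mx j.+1 *+ j.+1.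
Proof.
move=> lt_j; rewrite /string_mx -scalerAl -scalerAr -scalerBr ad_root_bracket //.
rewrite /pair_const sum_rootE -shift_rootS scalerA -intrM.
have [vS | vS] := boolP (v j.+1 \in root_seq Y); last first.
  by rewrite ad_root_out // !scaler0 mul0rn.
by rewrite string_constS // intrM -scalerA -scaler_nat pmulrn.
Qed.

Lemma string_mx_bracket3 : string_mx 3 * ad_root (val g) - ad_root (val g) * string_mx 3 = 0.
Proof.
rewrite /string_mx -scalerAl -scalerAr -scalerBr ad_root_bracket //.
rewrite /pair_const sum_rootE -shift_rootS scalerA -intrM.
have [vS | vS] := boolP (v 4%N \in root_seq Y); last by rewrite ad_root_out // scaler0.
by rewrite string_const3 // scale0r.
Qed.

Hypothesis class2 : string_class2 Y (root_seq Y) (val g) (val d).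
Local Notation z1 := (vadd (val d) (v 1%N)).
Local Notation z3 := (vadd (val d) (v 3%N)).

(** For y_j = [c j] e_(v j), this is the coefficient of e_(z1) in [y_1, y_0]; the next constant is
    that of e_(z3) in [y_3, y_0] + [y_2, y_1]. *)
Definition class2_const1 : int := c 1%N * pair_const (v 1%N) (val d).
Definition class2_const3 : int :=
  c 3%N * pair_const (v 3%N) (val d) + c 1%N * c 2%N * pair_const (v 2%N) (v 1%N).

(** This is [exp4_string] for a = -t ad e_g and y_j = t^j u [c j] ad e_(v j). Each of [k1] and [k3]
    is half of a commutator coefficient; prescribing their doubles allows values taken from a
    polynomial ring over the integers. *)
Lemma root_mx_conj_char0 (t u k1 k3 : K) :
    (z1 \in root_seq Y -> k1 *+ 2 = - (t * u ^+ 2 * class2_const1%:~R)) ->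
    (z3 \in root_seq Y -> k3 *+ 2 = - (t ^+ 3 * u ^+ 2 * class2_const3%:~R)) ->
  root_mx g (- t) * root_mx d u * root_mx g t
    = root_mx d u * vroot_mx (v 1%N) (t * u * (c 1%N)%:~R)
      * vroot_mx (v 2%N) (t ^+ 2 * u * (c 2%N)%:~R) * vroot_mx (v 3%N) (t ^+ 3 * u * (c 3%N)%:~R)
      * (vroot_mx z1 k1 * vroot_mx z3 k3) :> 'M[K]_n.+1.
Proof.
move=> def_k1 def_k3.
have [c02 c13 c23 cz nz13] := string_class2P class2.
have pz1 : positive z1 by apply: positive_vadd.
have pz3 : positive z3 by apply: positive_vadd.
have K2 : 2%:R != 0 :> K by apply: natK_neq0.
pose y j := (t ^+ j * u) *: string_mx j; pose a := (- t) *: ad_root (val g).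
have yE j : y j = (t ^+ j * u * (c j)%:~R) *: ad_root (v j) by rewrite /y scalerA.
have y0E : y 0%N = u *: ad_root (val d).
  by rewrite yE /string_const /string_prod big_ord0 mul1r mulr1.
have key x S : a * (x *: S) - (x *: S) * a
    = (t * x) *: (S * ad_root (val g) - ad_root (val g) * S).
  rewrite /a -!scalerAl -!scalerAr !scalerA [x * - t]mulrC -scalerBr.
  by rewrite mulNr scaleNr -scalerN opprB.
have ay j : (j < 3)%N -> a * y j - y j * a = y j.+1 *+ j.+1.
  by move=> lt_j; rewrite key string_mx_bracket // /y exprS -mulrA scalerMnr.
have ay3 : a * y 3%N - y 3%N * a = 0 by rewrite key string_mx_bracket3 scaler0.
have adcomm p q al be : positive p -> positive q ->
    (al *: ad_root p) * (be *: ad_root q) - (be *: ad_root q) * (al *: ad_root p)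
      = (al * be * (pair_const q p)%:~R) *: ad_root (vadd q p).
  move=> pp pq; rewrite -!scalerAl -!scalerAr !scalerA [be * al]mulrC -scalerBr.
  by rewrite ad_root_bracket // scalerA.
have commZ p q al be : positive p -> positive q ->
    (p \in root_seq Y -> q \in root_seq Y -> vadd p q \notin root_seq Y) ->
    GRing.comm (al *: ad_root p) (be *: ad_root q).
  move=> pp pq pq_out; rewrite /GRing.comm -!scalerAl -!scalerAr !scalerA.
  by rewrite comm_ad_root // mulrC.
pose w0 := (- k1) *: ad_root z1.
pose w1 := (2%:R^-1 * (t ^+ 3 * u ^+ 2 * (c 3%N * pair_const (v 3%N) (val d))%:~R)) *: ad_root z3.
pose w2 := (2%:R^-1 * (t ^+ 3 * u ^+ 2 * (c 1%N * c 2%N * pair_const (v 2%N) (v 1%N))%:~R)) *: ad_root z3.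
have w12 : w1 + w2 = (- k3) *: ad_root z3.
  have [z3Y | z3Y] := boolP (z3 \in root_seq Y); last first.
    by rewrite /w1 /w2 (ad_root_out z3Y) !scaler0 addr0.
  rewrite -scalerDl -mulrDr -mulrDr -intrD -/class2_const3; congr (_ *: _).
  apply: (mulfI K2); rewrite mulVKf // mulrN mulr_natl def_k3 ?opprK //.
have cen z al be j : z = z1 \/ z = z3 -> (j < 4)%N ->
    GRing.comm (al *: ad_root (v j)) (be *: ad_root z).
  move=> z13 lt_j; apply: commZ => // [|vj zY]; first by case: z13 => ->.
  by have [_] := cz z z13 zY; apply.
(* At most one of z1 and z3 is a root, so the exponential of the sum splits trivially. *)
have z13_0 : ad_root z1 = 0 \/ ad_root z3 = 0.
  by have [/nz13 | ] := boolP (z1 \in root_seq Y); [right | left]; apply: ad_root_out.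
have wE : w0 + w1 + w2 = - (k1 *: ad_root z1 + k3 *: ad_root z3).
  by rewrite -addrA w12 /w0 !scaleNr opprD.
have expw : exp4 (- (w0 + w1 + w2)) = vroot_mx z1 k1 * vroot_mx z3 k3.
  rewrite wE opprK !vroot_mxE //.
  by case: z13_0 => ->; rewrite !scaler0 exp4_0 ?add0r ?addr0 ?mul1r ?mulr1.
have w4 : (w0 + w1 + w2) ^+ 4 = 0.
  rewrite wE exprNn.
  by case: z13_0 => ->; rewrite !scaler0 ?add0r ?addr0 ad_rootZ4 ?mulr0.
have negt : t *: ad_root (val g) = - a by rewrite /a scaleNr opprK.
rewrite -expw !root_mxE // -y0E -/a negt !vroot_mxE //.
rewrite -[t * u]/(t ^+ 1 * u) -!yE.
have ay0 := ay 0%N isT; have ay1 := ay 1%N isT; have ay2 := ay 2%N isT.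
have c0 : (c 0%N)%:~R = 1 :> K by rewrite /string_const /string_prod big_ord0.
have z3E : vadd (v 2%N) (v 1%N) = z3 by rewrite vaddC /shift_root /= -!vaddA;
  do !rewrite (vaddCA _ (val d)).
have half2 x z : (2%:R^-1 * x) *: ad_root z *+ 2 = x *: ad_root z.
  by rewrite scalerMnl -[_ *+ 2]mulr_natl mulVKf.
have cenw j : (j < 4)%N -> [/\ GRing.comm (y j) w0, GRing.comm (y j) w1 & GRing.comm (y j) w2].
  by move=> lt_j; rewrite yE; split; apply: cen => //; [left | right | right].
have [cw00 cw01 cw02] := cenw 0%N isT; have [cw10 cw11 cw12] := cenw 1%N isT.
have [cw20 cw21 cw22] := cenw 2%N isT; have [cw30 cw31 cw32] := cenw 3%N isT.
have y4 j : y j ^+ 4 = 0 by rewrite yE ad_rootZ4.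
have a4 : a ^+ 4 = 0 by rewrite ad_rootZ4.
refine (exp4_string natK_neq0 a4 (y4 0%N) (y4 1%N) (y4 2%N) (y4 3%N) ay0 ay1 ay2 ay3
  _ _ _ _ _ _ cw00 cw01 cw02 cw10 cw11 cw12 cw20 cw21 cw22 cw30 cw31 cw32 w4);
  rewrite ?yE.
- by apply: commZ => // _; apply: c02.
- exact: commZ.
- exact: commZ.
- rewrite adcomm // vaddC -/z1 /w0; have [z1Y | z1Y] := boolP (z1 \in root_seq Y); last first.
    by rewrite ad_root_out // !scaler0 mul0rn.
  rewrite scalerMnl mulNrn def_k1 // opprK; congr (_ *: _).
  by rewrite c0 /class2_const1 intrM; ring.
- rewrite adcomm // vaddC -/z3 half2; congr (_ *: _).
  by rewrite c0 intrM; ring.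
- rewrite adcomm // z3E half2; congr (_ *: _).
  by rewrite !intrM; ring.
Qed.
End Commutator.
End CharZero.

(** Stated over any ring so that it can be carried along ring morphisms in both directions. The
    integers [m1] and [m3] are kept apart from [k1] and [k3]: when they vanish the last factors
    disappear, whatever the values of [k1] and [k3]. *)
Definition conj_rel (R : nzRingType) g d (m1 m3 : int) (t u k1 k3 : R) : Prop :=
  let v := shift_root (val g) (val d) in
  let c := string_const g d in
  root_mx g (- t) * root_mx d u * root_mx g t
  = root_mx d u * vroot_mx (v 1%N) (t * u * (c 1%N)%:~R)
    * vroot_mx (v 2%N) (t ^+ 2 * u * (c 2%N)%:~R) * vroot_mx (v 3%N) (t ^+ 3 * u * (c 3%N)%:~R)
    * (vroot_mx (vadd (val d) (v 1%N)) (k1 * m1%:~R)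
       * vroot_mx (vadd (val d) (v 3%N)) (k3 * m3%:~R)).

Lemma map_root_mxD (R S : comNzRingType) (f : {rmorphism R -> S}) g (s t : R) :
  root_mx g (s + t) = root_mx g s * root_mx g t ->
  root_mx g (f s + f t) = root_mx g (f s) * root_mx g (f t).
Proof. by move/(congr1 (map_mx f)); rewrite rmorphM /= !map_root_mx rmorphD. Qed.

Section MapConj.
Variables (R S : comNzRingType) (f : {rmorphism R -> S}).
Variables (g d : rootT Y) (m1 m3 : int) (t u k1 k3 : R).

Let map_coef i j : f (t ^+ i * u * (string_const g d j)%:~R)
  = f t ^+ i * f u * (string_const g d j)%:~R.
Proof. by rewrite 2!rmorphM rmorphXn rmorph_int. Qed.

Let map_coef1 : f (t * u * (string_const g d 1)%:~R) = f t * f u * (string_const g d 1)%:~R.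
Proof. exact: (map_coef 1 1). Qed.

Let map_const1 : f (k1 * m1%:~R) = f k1 * m1%:~R.
Proof. by rewrite rmorphM rmorph_int. Qed.

Let map_const3 : f (k3 * m3%:~R) = f k3 * m3%:~R.
Proof. by rewrite rmorphM rmorph_int. Qed.

Lemma map_conj_rel : conj_rel g d m1 m3 t u k1 k3 -> conj_rel g d m1 m3 (f t) (f u) (f k1) (f k3).
Proof.
rewrite /conj_rel => /(congr1 (map_mx f)); rewrite !rmorphM /=.
by rewrite !map_root_mx !map_vroot_mx map_coef1 !map_coef map_const1 map_const3 rmorphN.
Qed.

Lemma map_conj_rel_inj :
  injective f -> conj_rel g d m1 m3 (f t) (f u) (f k1) (f k3) -> conj_rel g d m1 m3 t u k1 k3.
Proof.
move=> f_inj conj_f; apply: (map_mx_injective f_inj); rewrite !rmorphM /=.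
by rewrite !map_root_mx !map_vroot_mx map_coef1 !map_coef map_const1 map_const3 rmorphN.
Qed.
End MapConj.

(** * Specialisation of polynomial identities to a field *)

Section Transfer.

Local Notation A := {poly {poly int}}.

Let K := {fraction A}.
Let iota : {rmorphism A -> K} := @tofrac A.

Let iota_inj : injective iota. Proof. by move=> x y /eqP; rewrite tofrac_eq => /eqP. Qed.

Let natK_neq0 m : m.+1%:R != 0 :> K.
Proof.
rewrite -(rmorph_nat iota) -(rmorph0 iota) (inj_eq iota_inj).
by rewrite -(rmorph_nat polyC) polyC_eq0 -(rmorph_nat polyC) polyC_eq0 pnatr_eq0.
Qed.

Variable F : fieldType.

(** Evaluation sending ['X%:P] to [t] and ['X] to [u]. *)
Let ev (t u : F) : {rmorphism A -> F} :=
  GRing.RMorphism.clone _ _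
    (horner_eval u \o map_poly (horner_eval t \o map_poly intr)) _.

Lemma root_mxD g (s t : F) : g \in posroots Y ->
  root_mx g (s + t) = root_mx g s * root_mx g t.
Proof.
move=> g_pos; pose sA : A := 'X%:P; pose tA : A := 'X.
have evs : ev s t sA = s by rewrite /= map_polyC /= /horner_eval hornerC map_polyX hornerX.
have evt : ev s t tA = t by rewrite /= map_polyX /horner_eval hornerX.
have := @map_root_mxD _ _ (ev s t) g sA tA; rewrite evs evt; apply.
apply: (map_mx_injective iota_inj); rewrite rmorphM /= !map_root_mx rmorphD.
exact: root_mxD_char0.
Qed.

Lemma root_mx_conj g d (t u : F) (v := shift_root (val g) (val d))
    (c := string_const g d) (z1 := vadd (val d) (v 1%N)) (z3 := vadd (val d) (v 3%N)) :
    g \in posroots Y -> d \in posroots Y ->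
    string_class2 Y (root_seq Y) (val g) (val d) ->
    (Y = TypeG2 -> 2%:R != 0 :> F) ->
  exists k1 k3 : F, conj_rel g d (class2_const1 g d) (class2_const3 g d) t u k1 k3.
Proof.
move=> g_pos d_pos cl2 F2.
have [_ _ _ cz _] := string_class2P cl2.
pose tA : A := 'X%:P.
have evt u0 : ev t u0 tA = t.
  by rewrite /= map_polyC /= /horner_eval hornerC map_polyX hornerX.
have evX u0 : ev t u0 'X = u0 by rewrite /= map_polyX /horner_eval hornerX.
(* In type G2 the constants k1 and k3 have denominator 2, cleared by evaluating
   at u / 2. *)
have [u0 [uA [k1 [k3 [evu def_k1 def_k3]]]]] : exists u0 (uA k1 k3 : A),
  [/\ ev t u0 uA = u,
      z1 \in root_seq Y -> (k1 * (class2_const1 g d)%:~R) *+ 2 = - (tA * uA ^+ 2 * (class2_const1 g d)%:~R) &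
      z3 \in root_seq Y -> (k3 * (class2_const3 g d)%:~R) *+ 2 = - (tA ^+ 3 * uA ^+ 2 * (class2_const3 g d)%:~R)].
  have [YG2 | YG2] := boolP (if Y is TypeG2 then true else false).
    have {YG2} YG2 : Y = TypeG2 by case: (Y) YG2.
    have F2' := F2 YG2.
    exists (u / 2%:R), ('X *+ 2), (- (tA * 'X ^+ 2 *+ 2)),
      (- (tA ^+ 3 * 'X ^+ 2 *+ 2)); split=> [|_|_].
    - by rewrite rmorphMn evX -[LHS]mulr_natr mulfVK.
    - by ring.
    - by ring.
  exists u, 'X, 0, 0; split=> [|zY|zY]; first exact: evX.
    by have [YG _] := cz z1 (or_introl erefl) zY; rewrite YG in YG2.
  by have [YG _] := cz z3 (or_intror erefl) zY; rewrite YG in YG2.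
exists (ev t u0 k1), (ev t u0 k3).
have := @map_conj_rel _ _ (ev t u0) g d (class2_const1 g d) (class2_const3 g d) tA uA k1 k3;
  rewrite evt evu; apply.
apply: (map_conj_rel_inj iota_inj).
apply: root_mx_conj_char0 => // zY; rewrite -?(rmorph_int iota) -?rmorphM -rmorphMn.
  by rewrite def_k1 // rmorphN 2!rmorphM rmorphXn rmorph_int.
by rewrite def_k3 // rmorphN 2!rmorphM !rmorphXn rmorph_int.
Qed.

End Transfer.
End RootMatrices.

(** * Root subgroups *)

Section RootSubgroups.

Variable Y : exc_type.
Implicit Types (g d e f : rootT Y) (S M : {set rootT Y}).
Variable N : rootT Y -> rootT Y -> int.
Hypothesis hN : chevalley_constants N.
Variable F : finFieldType.
Hypothesis Fgood : forall m, (0 < m <= max_bond Y)%N -> m%:R != 0 :> F.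
Implicit Types t u : F.
Local Notation I := (chev_index Y).
Local Notation n := #|I|.-1.
Local Notation lieF := (lieF Y F).
Local Notation xroot := (xroot N).
Local Notation root_mx := (root_mx N).
Local Notation vroot_mx := (vroot_mx N).

Lemma row_of_xroot g t (u : lieF) : row_of (xroot g t u) = row_of u *m root_mx g t.
Proof.
have -> : root_mx g t
    = mx_of (fun b c => \sum_(i < 4) t ^+ i * (ad_divpow N g i b c)%:~R).
  by apply/matrixP=> i j; rewrite root_mx_def summxE mxE; apply: eq_bigr => k _; rewrite !mxE.
by rewrite row_ofM; apply/rowP=> j; rewrite !mxE ffunE.
Qed.

Definition represents (s : {perm lieF}) (B : 'M[F]_n.+1) : Prop :=
  forall u : lieF, row_of (s u) = row_of u *m B.

Lemma represents1 : represents 1%g 1.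
Proof. by move=> u; rewrite perm1 mulmx1. Qed.

Lemma representsM s1 s2 B1 B2 :
  represents s1 B1 -> represents s2 B2 -> represents (s1 * s2)%g (B1 * B2).
Proof. by move=> r1 r2 u; rewrite permM r2 r1 mulmxA. Qed.

Lemma represents_inj s1 s2 B : represents s1 B -> represents s2 B -> s1 = s2.
Proof.
by move=> r1 r2; apply/permP=> u; apply/ffunP; apply: row_of_inj; rewrite r1 r2.
Qed.

(** That [xroot g t] is a permutation follows from its having the inverse [xroot g (- t)], which is
    established for positive [g]; the default value 1 fills the remaining cases. *)
Definition xelt g t : {perm lieF} :=
  odflt 1%g [pick s : {perm lieF} | [forall u, s u == xroot g t u]].

Lemma root_mx0 g : root_mx g (0 : F) = 1.
Proof.
rewrite root_mx_def big_ord_recl expr0 scale1r big1 ?addr0 => [|i _].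
  apply/matrixP=> i j; rewrite !mxE /ad_divpow divz1 ffunE (can_eq (@chev_idxK Y)).
  by rewrite eq_sym; case: eqP.
by rewrite exprS mul0r scale0r.
Qed.

Lemma root_mxV g t : g \in posroots Y -> root_mx g (- t) * root_mx g t = 1.
Proof. by move=> g_pos; rewrite -root_mxD // addNr root_mx0. Qed.

Lemma xroot_inj g t : g \in posroots Y -> injective (xroot g t).
Proof.
move=> g_pos u v eq_uv; apply/ffunP; apply: row_of_inj.
have := congr1 (fun w : lieF => row_of w *m root_mx g (- t)) eq_uv.
by rewrite !row_of_xroot -!mulmxA mulmxE -{1 3}(opprK t) root_mxV // !mulmx1.
Qed.

Lemma xeltE g t (w : lieF) : g \in posroots Y -> xelt g t w = xroot g t w.
Proof.
move=> g_pos; rewrite /xelt; case: pickP => [s /forallP/(_ w)/eqP // | no_s].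
have := no_s (perm (xroot_inj (t := t) g_pos)).
by case/forallP=> v; rewrite permE.
Qed.

Lemma represents_xelt g t : g \in posroots Y -> represents (xelt g t) (root_mx g t).
Proof. by move=> g_pos u; rewrite xeltE // row_of_xroot. Qed.

Lemma xeltD g s t : g \in posroots Y -> xelt g (s + t) = (xelt g s * xelt g t)%g.
Proof.
move=> g_pos; apply: represents_inj (represents_xelt _ g_pos) _.
by rewrite root_mxD //; apply: representsM; apply: represents_xelt.
Qed.

Lemma xelt0 g : g \in posroots Y -> xelt g 0 = 1%g.
Proof. by move=> g_pos; apply: (mulgI (xelt g 0)); rewrite -xeltD // addr0 mulg1. Qed.

Lemma xeltN g t : g \in posroots Y -> xelt g (- t) = (xelt g t)^-1%g.
Proof. by move=> g_pos; apply: (mulgI (xelt g t)); rewrite -xeltD // subrr xelt0 ?mulgV. Qed.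

Lemma rootsubP g (s : {perm lieF}) :
  g \in posroots Y -> reflect (exists t, s = xelt g t) (s \in rootsub N F g).
Proof.
move=> g_pos; rewrite inE; apply: (iffP existsP) => -[t].
  by move/forallP=> s_t; exists t; apply/permP=> u; rewrite xeltE //; apply/eqP.
by move->; exists t; apply/forallP=> u; rewrite xeltE.
Qed.

Lemma mem_Pgrp g t S : g \in posroots Y -> g \in S -> xelt g t \in Pgrp N F S.
Proof.
move=> g_pos gS; apply: mem_gen; apply/bigcupP; exists g => //.
by apply/rootsubP=> //; exists t.
Qed.

Definition vxelt (v : seq int) t : {perm lieF} := (\prod_(e | val e == v) xelt e t)%g.

Lemma vxelt_in e t : vxelt (val e) t = xelt e t.
Proof. by rewrite /vxelt (big_pred1 e) // => e'; rewrite val_eqE. Qed.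

Lemma vxelt_out v t : v \notin root_seq Y -> vxelt v t = 1%g.
Proof.
move=> vY; apply: big_pred0 => e.
by apply: contraNF vY => /eqP <-; apply: roots_val.
Qed.

Lemma represents_vxelt v t : positive v -> represents (vxelt v t) (vroot_mx v t).
Proof.
apply: (@root_ind Y (fun v => positive v -> _)) => [e | vY _]; last first.
  by rewrite vxelt_out // vroot_mx_out //; apply: represents1.
by rewrite -posrootsE vxelt_in vroot_mx_in; apply: represents_xelt.
Qed.

Lemma vxelt0 v : positive v -> vxelt v 0 = 1%g.
Proof.
apply: (@root_ind Y (fun v => positive v -> _)) => [e | vY _]; last by rewrite vxelt_out.
by rewrite -posrootsE vxelt_in; apply: xelt0.
Qed.

Lemma vxelt_Pgrp v t M : positive v ->
  (forall e, val e = v -> e \in M) -> vxelt v t \in Pgrp N F M.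
Proof.
move=> v_pos vM; apply: group_prod => e /eqP e_v.
by apply: mem_Pgrp; rewrite ?vM // posrootsE e_v.
Qed.

Lemma comm_class2 g d t u (v := shift_root (val g) (val d)) (c := string_const N g d)
    (z1 := vadd (val d) (v 1%N)) (z3 := vadd (val d) (v 3%N)) :
    g \in posroots Y -> d \in posroots Y ->
    string_class2 Y (root_seq Y) (val g) (val d) ->
  exists k1 k3 : F,
    [~ xelt d u, xelt g t]
    = (vxelt (v 1%N) (t * u * (c 1%N)%:~R)%R * vxelt (v 2%N) (t ^+ 2 * u * (c 2%N)%:~R)%R
       * vxelt (v 3%N) (t ^+ 3 * u * (c 3%N)%:~R)%R
       * (vxelt z1 (k1 * (class2_const1 N g d)%:~R)%R * vxelt z3 (k3 * (class2_const3 N g d)%:~R)%R))%g.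
Proof.
move=> g_pos d_pos cl2.
have F2 : Y = TypeG2 -> 2%:R != 0 :> F by move=> YG2; apply: Fgood; rewrite YG2.
have [k1 [k3 conj_gd]] := root_mx_conj hN t u g_pos d_pos cl2 F2.
have [pg pd] : positive (val g) /\ positive (val d) by rewrite -!posrootsE.
have pv j : positive (v j) by apply: positive_shift_root.
exists k1, k3; apply: (mulgI (xelt d u)); rewrite -conjg_mulR conjgE !mulgA.
apply: represents_inj (_ : represents _ (root_mx g (- t) * root_mx d u * root_mx g t)) _.
  rewrite -xeltN //; apply: representsM; last exact: represents_xelt.
  by apply: representsM; apply: represents_xelt.
rewrite conj_gd !mulrA.
have pz j : positive (vadd (val d) (v j)) by apply: positive_vadd.
do 5![apply: representsM; last by apply: represents_vxelt; (exact: pz || exact: pv)].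
exact: represents_xelt.
Qed.

(** [M] takes in the roots of the commutator of x_g and x_d other than e = g + d: each arises from e
    or from a root of [M] by adding g, d or another such root. The root e may lie outside [M]; in
    the pairing of arm and leg it is alpha, and [M] is k(alpha). *)
Definition absorbs g d M : Prop :=
  forall e h x, is_sum g d e -> h \in e |: M ->
    (is_sum g h x \/ is_sum d h x \/ exists2 h', h' \in e |: M & is_sum h h' x) -> x \in M.

Lemma absorbsC g d M : absorbs g d M -> absorbs d g M.
Proof.
move=> abs e h x; rewrite is_sumC => gde hM hx; apply: (abs e h x) => //.
by case: hx => [|[|]]; [right; left | left | right; right].
Qed.

(** The constant is [N g d], whose absolute value lies between 1 and [max_bond Y]: here the bound on
    p makes the leading coefficient of a commutator invertible. *)
Lemma string_const1_neq0 g d e : g \in posroots Y -> d \in posroots Y -> is_sum g d e ->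
  (string_const N g d 1)%:~R != 0 :> F.
Proof.
move=> g_pos d_pos gde; rewrite /string_const string_prod1 divz1.
have dNg : val d != vscale (-1) (val g) by apply: pos_neq_neg; rewrite -?posrootsE.
have v1 : shift_root (val g) (val d) 1 \in root_seq Y.
  by move: gde; rewrite shift_rootS shift_root0 /is_sum => /eqP <-; apply: roots_val.
have [_ /(_ d_pos) le_max _ _] := string_okP g_pos dNg v1.
have := abs_string_const hN (roots_val d) v1; rewrite sum_rootE => absN.
have natN : (`|N g d|%N)%:R != 0 :> F.
  by apply: Fgood; rewrite absN; apply: le_max.
by rewrite [N g d]intEsign rmorphM rmorph_sign /= mulf_eq0 signr_eq0.
Qed.

Lemma comm_root_class2 g d e : g \in posroots Y -> d \in posroots Y -> is_sum g d e ->
    string_class2 Y (root_seq Y) (val g) (val d) ->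
  exists2 c : F, c != 0 & forall M t u, M \subset posroots Y -> absorbs g d M ->
    exists2 r, r \in Pgrp N F M & [~ xelt d u, xelt g t] = (xelt e (c * t * u)%R * r)%g.
Proof.
move=> g_pos d_pos gde cl2; exists (string_const N g d 1)%:~R.
  exact: string_const1_neq0 gde.
move=> M t u sM abs; have [k1 [k3 ->]] := comm_class2 t u g_pos d_pos cl2.
set v := shift_root (val g) (val d).
have v1E : v 1%N = val e by rewrite /v shift_rootS shift_root0; move: gde;
  rewrite /is_sum => /eqP <-.
have [pg pd] : positive (val g) /\ positive (val d) by rewrite -!posrootsE.
have pv j : positive (v j) by apply: positive_shift_root.
have pz j : positive (vadd (val d) (v j)) by apply: positive_vadd.
have eM : e \in e |: M by rewrite setU11.
have absv h w x : h \in e |: M -> val h = w ->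
    (val x = vadd (val g) w \/ val x = vadd (val d) w) -> x \in M.
  move=> hM <- hx; apply: (abs e h x) => //.
  by case: hx => hx; [left | right; left]; rewrite /is_sum hx.
have v2M h : val h = v 2%N -> h \in M.
  by move=> h2; apply: (absv e _ h eM (esym v1E)); left; rewrite h2.
rewrite v1E vxelt_in -!mulgA.
eexists; last by congr (xelt e _ * _)%g; rewrite mulrC mulrA.
apply: groupM; first exact: vxelt_Pgrp.
have pze : positive (vadd (val d) (val e)) by rewrite -v1E.
have z1M h : val h = vadd (val d) (val e) -> h \in M.
  by move=> hz; apply: (absv e _ h eM erefl); right.
(* If [v 2] is not a root, the constants of all later terms of the string and of z3 vanish, and only
   z1 can remain. *)
have [v2 | v2] := boolP (v 2%N \in root_seq Y); last first.
  have c3 : string_const N g d 3 = 0.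
    by rewrite /string_const (string_prod_stop _ v2) // div0z.
  have -> : class2_const3 N g d = 0.
    by rewrite /class2_const3 c3 mul0r add0r /pair_const sum_root_out // mulr0.
  by rewrite c3 !mulr0 !vxelt0 // mul1g mulg1; apply: vxelt_Pgrp.
have [h2 h2E] := root_seqP v2; have h2M := v2M _ h2E.
have h2T : h2 \in e |: M by rewrite inE h2M orbT.
apply: groupM; first apply: vxelt_Pgrp => // h h3; first by apply: (absv h2 _ h h2T h2E); left.
apply: groupM; first exact: vxelt_Pgrp.
(* z3 is the sum of e and [v 2], hence lies in [M]. *)
apply: vxelt_Pgrp => // h hz3; apply: (abs e e h) => //.
right; right; exists h2; rewrite // /is_sum h2E -v1E hz3; apply/eqP.
by rewrite /v !shift_rootS shift_root0 -!vaddA; do !rewrite (vaddCA _ (val d)).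
Qed.

(** The string condition may hold only with g and d exchanged. The commutator is then the inverse of
    one of the form x_e r, which puts the remaining factor on the left; hence [r] and [r'] on either
    side. *)
Lemma comm_root g d e : g \in posroots Y -> d \in posroots Y -> is_sum g d e ->
  exists2 c : F, c != 0 & forall M t u, M \subset posroots Y -> absorbs g d M ->
    exists r r', [/\ r \in Pgrp N F M, r' \in Pgrp N F M &
      [~ xelt d u, xelt g t] = (r * xelt e (c * t * u)%R * r')%g].
Proof.
move=> g_pos d_pos gde.
have e_pos : e \in posroots Y by apply: posroots_sum gde _ _.
case/orP: (string_class2_or g_pos d_pos) => cl2.
  have [c c0 comm_c] := comm_root_class2 g_pos d_pos gde cl2.
  exists c => // M t u sM abs; have [r rM ->] := comm_c M t u sM abs.
  by exists 1%g, r; rewrite group1 rM mul1g.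
have deg : is_sum d g e by rewrite is_sumC.
have [c c0 comm_c] := comm_root_class2 d_pos g_pos deg cl2.
exists (- c); first by rewrite oppr_eq0.
move=> M t u sM abs; have [r rM E] := comm_c M u t sM (absorbsC abs).
exists r^-1%g, 1%g; rewrite groupV rM group1 mulg1 -invg_comm E invMg -xeltN //.
by rewrite !mulNr mulrAC.
Qed.

Lemma comm_root0 g d t u : g \in posroots Y -> d \in posroots Y ->
  vadd (val g) (val d) \notin root_seq Y -> commute (xelt d u) (xelt g t).
Proof.
move=> g_pos d_pos; wlog cl2 : g d t u g_pos d_pos / string_class2 Y (root_seq Y) (val g) (val d).
  move=> comm_gd gdY; case/orP: (string_class2_or g_pos d_pos) => cl2.
    exact: comm_gd.
  by apply/commute_sym/comm_gd => //; rewrite vaddC.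
move=> gdY; apply/commgP; have [k1 [k3 ->]] := comm_class2 t u g_pos d_pos cl2.
set v := shift_root (val g) (val d).
have [pg pd] : positive (val g) /\ positive (val d) by rewrite -!posrootsE.
have pv j : positive (v j) by apply: positive_shift_root.
have pz j : positive (vadd (val d) (v j)) by apply: positive_vadd.
have v1 : v 1%N \notin root_seq Y := gdY.
have c0 j : (1 < j)%N -> string_const N g d j = 0.
  by move=> j1; rewrite /string_const (string_prod_stop _ v1 j1) div0z.
have -> : class2_const1 N g d = 0 by rewrite /class2_const1 /pair_const (sum_root_out _ v1) mulr0.
have -> : class2_const3 N g d = 0 by rewrite /class2_const3 (c0 2%N) // (c0 3%N) // mulr0 !mul0r addr0.
by rewrite (c0 2%N) // (c0 3%N) // !mulr0 !vxelt0 // vxelt_out // !mulg1.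
Qed.

Lemma closed_pattern_pos S : closed_pattern S -> {subset S <= posroots Y}.
Proof. by case/andP=> /subsetP. Qed.

Lemma closed_pattern_sum S g d e :
  closed_pattern S -> g \in S -> d \in S -> is_sum g d e -> e \in S.
Proof.
move=> cS gS dS gde; have pS := closed_pattern_pos cS.
have e_pos : e \in posroots Y by apply: posroots_sum gde _ _; apply: pS.
case/andP: cS => _ /forall_inP/(_ g gS)/forall_inP/(_ d dS)/forall_inP/(_ e e_pos).
by rewrite gde.
Qed.

(** * Action of pattern subgroups on the Cartan part *)

Section Support.

Variable S : {set rootT Y}.
Hypothesis cS : closed_pattern S.

Definition in_supp (b : I) : bool := if b is inr f then f \in S else false.

Let suppZ (w : {ffun I -> int}) : Prop := forall b, ~~ in_supp b -> w b = 0.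
Definition supported (w : lieF) : Prop := forall b, ~~ in_supp b -> w b = 0.

Let bracket_supp f w : f \in S -> suppZ w -> suppZ (bracket N (basis_vec (inr f)) w).
Proof.
move=> fS supp_w c cS'; rewrite [w]basis_vec_sum bracket_sumr sum_ffunE big1 // => b _.
rewrite bracketMzr ffunMzE.
have [bS | /supp_w->] := boolP (in_supp b); last by rewrite mulr0z.
case: b bS => //= f' f'S; have [f_pos f'_pos] : f \in posroots Y /\ f' \in posroots Y.
  by split; apply: closed_pattern_pos cS _ _.
have neg : val f' != vscale (-1) (val f) by apply: pos_neq_neg; rewrite -?posrootsE.
rewrite bracket_basis /= (negPf neg) sum_ffunE big1 ?mul0rz // => e ffe.
rewrite ffunMzE ffunE; case: eqP => [c_e | _]; last by rewrite mul0rz.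
by rewrite c_e /= (closed_pattern_sum cS fS f'S ffe) in cS'.
Qed.

Let iter_supp f w i : f \in S -> suppZ w -> suppZ (iter i (bracket N (basis_vec (inr f))) w).
Proof. by move=> fS supp_w; elim: i => // i; apply: bracket_supp. Qed.

Let suppZ_basis f : f \in S -> suppZ (basis_vec (inr f)).
Proof. by move=> fS c cS'; rewrite ffunE; case: eqP cS' => // ->; rewrite /= fS. Qed.

Definition cartan_vec (i : 'I_(rank Y)) : lieF := [ffun c => (c == inl i)%:R].

(** Additivity and stability of the span of the e_f with f in [S] make the third condition, the one
    of interest, stable under products. *)
Let fixes_cartan (s : {perm lieF}) : Prop :=
  [/\ forall v w, s (v + w) = s v + s w,
      forall w, supported w -> supported (s w)
    & forall i, supported (s (cartan_vec i) - cartan_vec i)].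

Let fixes_cartan_mul s1 s2 :
  fixes_cartan s1 -> fixes_cartan s2 -> fixes_cartan (s1 * s2)%g.
Proof.
move=> [add1 sup1 car1] [add2 sup2 car2]; split=> [v w | w supp_w | i].
- by rewrite !permM add1 add2.
- by rewrite permM; apply/sup2/sup1.
move=> b nb; rewrite permM -[s1 _](subrK (cartan_vec i)) add2 -addrA ffunE.
by rewrite (sup2 _ (car1 i) b nb) add0r (car2 i b nb).
Qed.

Let fixes_cartan_root g t : g \in S -> fixes_cartan (xelt g t).
Proof.
move=> gS; have g_pos := closed_pattern_pos cS gS.
split=> [v w | w supp_w b nb | i b nb].
- rewrite !xeltE //; apply/ffunP=> c; rewrite !ffunE -big_split /=.
  by apply: eq_bigr => b _; rewrite ffunE mulrDl.
- rewrite xeltE // ffunE big1 // => b' _.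
  have [b'S | /supp_w->] := boolP (in_supp b'); last by rewrite mul0r.
  rewrite big1 ?mulr0 // => i _; case: b' b'S => //= f fS.
  by rewrite /ad_divpow (iter_supp _ gS (suppZ_basis fS)) // div0z mulr0.
rewrite !ffunE xeltE // ffunE (bigD1 (inl i)) //= ffunE eqxx mul1r.
rewrite [X in (_ + X) - _]big1 ?addr0 => [|b' /negPf nb']; last by rewrite ffunE nb' mul0r.
rewrite big_ord_recl big1 ?addr0 => [|k _].
  by rewrite expr0 mul1r /ad_divpow divz1 ffunE; case: (b == _); rewrite subrr.
have supp1 : suppZ (bracket N (basis_vec (inr g)) (basis_vec (inl i))).
  move=> c nc; rewrite bracket_basis_cartan ffunMzE.
  by rewrite (suppZ_basis gS nc) mul0rz.
by rewrite /ad_divpow lift0 iterSr (iter_supp _ gS supp1) // div0z mulr0.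
Qed.

Lemma cartan_supported (s : {perm lieF}) i :
  s \in Pgrp N F S -> supported (s (cartan_vec i) - cartan_vec i).
Proof.
suff fixP : s \in Pgrp N F S -> fixes_cartan s by move=> /fixP[].
case/gen_prodgP=> m [c cP ->]; apply: (big_ind fixes_cartan).
- split=> [v w | w | j b _]; rewrite ?perm1 // ?subrr ?ffunE //.
- exact: fixes_cartan_mul.
move=> j _; have /bigcupP[g gS] := cP j.
by case/(rootsubP _ (closed_pattern_pos cS gS)) => t ->; apply: fixes_cartan_root.
Qed.

(** Elements of P(S) move h_i by combinations of the e_f with f in [S], whereas x_g(t) adds to h_i
    the term -t times a Cartan integer times e_g. For a suitable i this integer is nonzero in the
    field. *)
Lemma xelt_notin_Pgrp g t :
  g \in posroots Y -> g \notin S -> xelt g t \in Pgrp N F S -> t = 0.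
Proof.
move=> g_pos gS xS; have [i c0 cm] := cartan_int_bond g_pos.
have /(_ (inr g) gS) := cartan_supported i xS.
rewrite !ffunE xeltE // ffunE (bigD1 (inl i)) //= ffunE eqxx mul1r.
rewrite [X in (_ + X) - _]big1 ?addr0 => [|b' /negPf nb']; last by rewrite ffunE nb' mul0r.
have D1 : ad_divpow N g 1 (inl i) (inr g) = - cartan_int Y (val g) i.
  by rewrite /ad_divpow divz1 /iter bracket_basis_cartan ffunMzE ffunE eqxx mulrzz mul1r.
have D2 k : ad_divpow N g k.+2 (inl i) (inr g) = 0.
  rewrite /ad_divpow !iterSr bracket_basis_cartan bracketMzr bracket_alt //.
  by rewrite mul0rz iter_bracket0 ffunE div0z.
rewrite big_ord_recl big_ord_recl big1 ?addr0 => [|k _]; last by rewrite !lift0 D2 mulr0.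
rewrite lift0 D1 /ad_divpow divz1 ffunE /= expr0 expr1 mulr0 add0r subr0.
move/eqP; rewrite mulf_eq0 => /orP[/eqP // | ].
rewrite mulrNz oppr_eq0 [cartan_int _ _ _]intEsign rmorphM rmorph_sign /=.
by rewrite mulf_eq0 signr_eq0 /= (negPf (Fgood _)) ?c0.
Qed.

End Support.

End RootSubgroups.

(** * Pattern subgroups *)

(** Modulo [M] the claim is that sets commuting elementwise generate commuting subgroups. *)
Lemma commg_gen_sub (gT : finGroupType) (A B : {set gT}) (M : {group gT}) :
    A \subset 'N(M) -> B \subset 'N(M) ->
    (forall x y, x \in A -> y \in B -> [~ x, y] \in M) ->
  [~: <<A>>, <<B>>] \subset M.
Proof.
move=> nMA nMB cAB; rewrite -quotient_cents2 ?gen_subG // !quotient_gen //.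
rewrite gen_subG centsC gen_subG centsC quotient_cents2 //.
by rewrite gen_subG; apply/subsetP=> _ /imset2P[x y Ax By ->]; apply: cAB.
Qed.

Lemma vadd_inj u v w : size u = size w -> size v = size w -> vadd u w = vadd v w -> u = v.
Proof.
elim: w u v => [|z w IHw] [|x u] [|y v] // [su] [sv]; rewrite !vadd_cons => -[/addIr-> eq_uv].
by rewrite (IHw u v).
Qed.

Section PatternSubgroups.

Variable Y : exc_type.
Implicit Types (g d e f : rootT Y) (S M A B : {set rootT Y}).

Lemma is_sum_inj g g' d e : is_sum g d e -> is_sum g' d e -> g = g'.
Proof.
rewrite /is_sum => /eqP gd /eqP g'd; apply/val_inj/(@vadd_inj _ _ (val d)).
- by rewrite !size_root.
- by rewrite !size_root.
- by rewrite -gd.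
Qed.

Lemma is_sum_uniq g d e e' : is_sum g d e -> is_sum g d e' -> e = e'.
Proof. by rewrite /is_sum => /eqP de /eqP de'; apply: val_inj; rewrite de de'. Qed.

Lemma normal_pattern_closed M S : normal_pattern M S -> closed_pattern S.
Proof. by case/and3P. Qed.

Lemma normal_pattern_sub M S : normal_pattern M S -> M \subset S.
Proof. by case/and3P. Qed.

Lemma normal_pattern_sum M S g d e :
  normal_pattern M S -> g \in M -> d \in S -> is_sum g d e -> e \in M.
Proof.
case/and3P=> cS sMS nMS gM dS gde; have pS := closed_pattern_pos cS.
have e_pos : e \in posroots Y := posroots_sum gde (pS _ (subsetP sMS _ gM)) (pS _ dS).
move/forall_inP: nMS => /(_ g gM)/forall_inP/(_ d dS)/forall_inP/(_ e e_pos).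
by rewrite gde.
Qed.

Lemma normal_patternI M S :
    closed_pattern S -> M \subset S ->
    (forall g d e, g \in M -> d \in S -> is_sum g d e -> e \in M) ->
  normal_pattern M S.
Proof.
move=> cS sMS nMS; apply/and3P; split=> //.
apply/forall_inP=> g gM; apply/forall_inP=> d dS; apply/forall_inP=> e _.
by apply/implyP; apply: nMS.
Qed.

Lemma closed_posroots : closed_pattern (posroots Y).
Proof.
apply/andP; split=> //; apply/forall_inP=> g g_pos; apply/forall_inP=> d d_pos.
by apply/forall_inP=> e e_pos; apply/implyP.
Qed.

Variable N : rootT Y -> rootT Y -> int.
Hypothesis hN : chevalley_constants N.
Variable F : finFieldType.
Hypothesis Fgood : forall m, (0 < m <= max_bond Y)%N -> m%:R != 0 :> F.
Implicit Types t u : F.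
Local Notation xelt := (@xelt Y N F).
Local Notation P := (Pgrp N F).

Lemma PgrpS S M : S \subset M -> P S \subset P M.
Proof.
move=> /subsetP sSM; apply: genS; apply/bigcupsP=> g gS.
by apply: bigcup_sup; apply: sSM.
Qed.

Lemma PgrpU S M : P (S :|: M) = P S <*> P M :> {set _}.
Proof. by rewrite /= bigcup_setU joing_idl joing_idr. Qed.

Lemma sub_PgrpP (S : {set rootT Y}) (A : {group {perm lieF Y F}}) :
    S \subset posroots Y ->
  reflect (forall g t, g \in S -> xelt g t \in A) (P S \subset A).
Proof.
move=> /subsetP pS; rewrite gen_subG; apply: (iffP bigcupsP) => [sSA g t gS | xA g gS].
  by apply: (subsetP (sSA g gS)); apply/(rootsubP hN _ (pS g gS)); exists t.
by apply/subsetP=> _ /(rootsubP hN _ (pS g gS))[t ->]; apply: xA.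
Qed.

Lemma rootsub_group_set g : g \in posroots Y -> group_set (rootsub N F g).
Proof.
move=> g_pos; apply/group_setP; split.
  by apply/(rootsubP hN _ g_pos); exists 0; rewrite xelt0.
move=> _ _ /(rootsubP hN _ g_pos)[t ->] /(rootsubP hN _ g_pos)[u ->].
by apply/(rootsubP hN _ g_pos); exists (t + u); rewrite xeltD.
Qed.

Lemma Pgrp1 g : g \in posroots Y -> P [set g] = rootsub N F g :> {set _}.
Proof.
move=> g_pos; rewrite /= big_set1.
by rewrite -[RHS]/(gval (Group (rootsub_group_set g_pos))) -[RHS]genGid.
Qed.

Lemma Pgrp1P g s : g \in posroots Y -> reflect (exists t, s = xelt g t) (s \in P [set g]).
Proof. by move=> g_pos; rewrite Pgrp1 //; apply: rootsubP. Qed.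

Lemma absorbs_normal M S g d :
    normal_pattern M S -> g \in S -> d \in S ->
    (forall e, is_sum g d e -> e \in M) ->
  absorbs g d M.
Proof.
move=> nMS gS dS gdM e h x gde; have eM := gdM e gde.
have sum := normal_pattern_sum nMS; have sMS := subsetP (normal_pattern_sub nMS).
have sub h' : h' \in e |: M -> h' \in M by case/setU1P=> [->|].
move/sub=> hM [|[|[h' /sub h'M]]] hx.
- by apply: sum hM gS _; rewrite is_sumC.
- by apply: sum hM dS _; rewrite is_sumC.
by apply: sum hM (sMS _ h'M) hx.
Qed.

Lemma comm_xelt_normal M S g d t u :
    normal_pattern M S -> g \in S -> d \in S ->
    (forall e, is_sum g d e -> e \in M) ->
  [~ xelt d u, xelt g t] \in P M.
Proof.
move=> nMS gS dS gdM; have pS := closed_pattern_pos (normal_pattern_closed nMS).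
have [g_pos d_pos] := (pS g gS, pS d dS).
have abs := absorbs_normal nMS gS dS gdM.
have [gdY | gdY] := boolP (vadd (val g) (val d) \in root_seq Y); last first.
  by have /commgP/eqP-> := comm_root0 hN Fgood t u g_pos d_pos gdY; apply: group1.
have [e eE] := root_seqP gdY; have gde : is_sum g d e by rewrite /is_sum eE.
have [c _ comm_gd] := comm_root hN Fgood g_pos d_pos gde.
have sMpos : M \subset posroots Y.
  by apply: subset_trans (normal_pattern_sub nMS) _; apply/subsetP.
have [r [r' [rM r'M ->]]] := comm_gd M t u sMpos abs.
have eM := gdM e gde.
by rewrite !groupM // mem_Pgrp // (subsetP sMpos).
Qed.

Lemma Pgrp_comm_sub M S A B :
    normal_pattern M S -> A \subset S -> B \subset S ->
    (forall g d e, g \in A -> d \in B -> is_sum g d e -> e \in M) ->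
    P S \subset 'N(P M) ->
  [~: P A, P B] \subset P M.
Proof.
move=> nMS sAS sBS ABM nSM; have pS := closed_pattern_pos (normal_pattern_closed nMS).
have nrm (C : {set rootT Y}) : C \subset S -> \bigcup_(g in C) rootsub N F g \subset 'N(P M).
  move=> sCS; apply: subset_trans nSM; apply: sub_gen.
  by apply/bigcupsP=> g gC; apply: bigcup_sup; apply: (subsetP sCS).
apply: commg_gen_sub; rewrite ?nrm // => x y /bigcupP[d dA] + /bigcupP[g gB].
have [dS gS] := (subsetP sAS _ dA, subsetP sBS _ gB).
case/(rootsubP hN _ (pS d dS))=> u -> /(rootsubP hN _ (pS g gS))[t ->].
apply: (comm_xelt_normal _ _ nMS gS dS) => e gde.
by apply: ABM dA gB _; rewrite is_sumC.
Qed.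

Lemma Pgrp_normal M S : normal_pattern M S -> P M <| P S.
Proof.
move=> nMS; have sMS := normal_pattern_sub nMS.
have pS := closed_pattern_pos (normal_pattern_closed nMS).
rewrite /normal PgrpS //; apply/sub_PgrpP => [|g t gS]; first exact/subsetP.
rewrite inE -genJ gen_subG; apply/subsetP=> _ /imsetP[x /bigcupP[d dM] + ->].
have dS := subsetP sMS _ dM.
case/(rootsubP hN _ (pS d dS))=> u ->; rewrite conjg_mulR groupM //.
  by rewrite mem_Pgrp // pS.
apply: (comm_xelt_normal _ _ nMS gS dS) => e gde.
by apply: normal_pattern_sum nMS dM gS _; rewrite is_sumC.
Qed.

Lemma PgrpU1 S g : g \in posroots Y -> P [set g] \subset 'N(P S) ->
  P (g |: S) = (P S * P [set g])%g :> {set _}.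
Proof. by move=> g_pos nSg; rewrite setUC PgrpU norm_joinEr. Qed.

End PatternSubgroups.

(** * Arms *)

Section Arms.

Variable Y : exc_type.
Implicit Types (b g d e f : rootT Y) (S M A B : {set rootT Y}).
Local Notation ht g := (height (val g)).
Local Notation pos := (posroots Y).

Variable alpha : rootT Y.
Hypothesis alpha_pos : alpha \in pos.
Local Notation k := (kpat alpha).

Lemma height_lt_sum g d e : is_sum g d e -> d \in pos -> ht g < ht e.
Proof. by move/height_sum->; move/height_posroot; rewrite ltrDl. Qed.

Lemma kpat_normal : normal_pattern k pos.
Proof.
apply: normal_patternI; first exact: closed_posroots.
  by apply/bigcupsP=> M /andP[nM _]; apply: normal_pattern_sub nM.
move=> g d e /bigcupP[M nM gM] d_pos gde; apply/bigcupP; exists M => //.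
by case/andP: nM => nM _; apply: normal_pattern_sum nM gM d_pos gde.
Qed.

Lemma kpat_pos : k \subset pos. Proof. exact: normal_pattern_sub kpat_normal. Qed.

Lemma alpha_notin_kpat : alpha \notin k.
Proof. by apply/bigcupP=> -[M /andP[_ /negPf->]]. Qed.

Lemma kpat_max M : normal_pattern M pos -> alpha \notin M -> M \subset k.
Proof. by move=> nM aM; apply: bigcup_sup; rewrite nM. Qed.

(** The roots with these properties form a normal pattern that avoids [alpha]. *)
Lemma kpat_high e : e \in pos -> ht alpha <= ht e -> e != alpha -> e \in k.
Proof.
move=> e_pos le_ae ne_ea; pose M := [set f in pos | (ht alpha <= ht f) && (f != alpha)].
have memM f : (f \in M) = [&& f \in pos, ht alpha <= ht f & f != alpha] by rewrite [LHS]in_set.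
suff nM : normal_pattern M pos.
  have aM : alpha \notin M by rewrite memM eqxx !andbF.
  by apply: (subsetP (kpat_max nM aM)); rewrite memM e_pos le_ae.
apply: normal_patternI; first exact: closed_posroots.
  by apply/subsetP=> f; rewrite memM => /andP[].
move=> g d f; rewrite !memM => /and3P[g_pos le_ag _] d_pos gdf.
have lt_gf := height_lt_sum gdf d_pos.
rewrite (posroots_sum gdf g_pos d_pos) (le_trans le_ag (ltW lt_gf)) /=.
by apply: contraTneq lt_gf => ->; rewrite -leNgt.
Qed.

Lemma kpat_above g e : g \in pos -> is_sum alpha g e -> e \in k.
Proof.
move=> g_pos age; have lt_ae := height_lt_sum age g_pos.
apply: kpat_high; first exact: posroots_sum age _ _.
  exact: ltW.
by apply: contraTneq lt_ae => ->; rewrite ltxx.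
Qed.

Variables a l : {set rootT Y}.
Hypothesis good : good_arm alpha a l.

Let arm : is_arm alpha a l. Proof. by case: good. Qed.

Lemma hook_pos g : g \in hook alpha -> g \in pos.
Proof. by rewrite [g \in hook _]inE => /andP[]. Qed.

Lemma arm_pos g : g \in a -> g \in pos.
Proof.
by move=> ga; apply: hook_pos; have [-> _ _ _] := arm; rewrite !inE ga orbT.
Qed.

Lemma leg_pos g : g \in l -> g \in pos.
Proof.
by move=> gl; apply: hook_pos; have [-> _ _ _] := arm; rewrite !inE gl !orbT.
Qed.

Lemma leg_notin_arm g : g \in l -> g \notin a.
Proof. by have [_ [_ _ dis] _ _] := arm; move=> gl; rewrite (disjointFl dis gl). Qed.

Lemma alpha_notin_arm : alpha \notin a. Proof. by have [_ []] := arm. Qed.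

Lemma arm_partner b : b \in a -> exists2 g, g \in l & is_sum b g alpha.
Proof.
by have [_ _ _ part] := arm; move=> /part[g [[gl bg] _]]; exists g.
Qed.

(** Taking partners is an injection from the arm to the leg, since a summand is determined by the
    other one; the equality of cardinals makes it surjective. *)
Lemma leg_partner g : g \in l -> exists2 b, b \in a & is_sum b g alpha.
Proof.
move=> gl; pose part b := odflt b [pick h in l | is_sum b h alpha].
have partP b : b \in a -> part b \in l /\ is_sum b (part b) alpha.
  move=> ba; rewrite /part; case: pickP => [h /andP[] // | no_h].
  by have [h hl bh] := arm_partner ba; have := no_h h; rewrite hl bh.
have part_inj : {in a &, injective part}.
  move=> b b' ba b'a eq_part; have [_ bs] := partP b ba; have [_ b's] := partP b' b'a.
  by rewrite -eq_part in b's; apply: is_sum_inj bs b's.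
have im_part : part @: a = l.
  apply/eqP; rewrite eqEcard card_in_imset //; have [_ _ -> _] := arm; rewrite leqnn andbT.
  by apply/subsetP=> _ /imsetP[b ba ->]; case: (partP b ba).
by move: gl; rewrite -im_part => /imsetP[b ba ->]; exists b => //; case: (partP b ba).
Qed.

(* Otherwise both would lie in the leg. *)
Lemma sum_alpha_arm g d : g \in pos -> d \in pos -> is_sum g d alpha -> (g \in a) || (d \in a).
Proof.
move=> g_pos d_pos gd.
have hookP x y : x \in pos -> y \in pos -> is_sum x y alpha -> x \in a \/ x \in l.
  move=> x_pos y_pos xy; have : x \in hook alpha.
    by rewrite inE x_pos; apply/orP; right; apply/exists_inP; exists y.
  have [-> _ _ _] := arm; rewrite !inE => /or3P[/eqP x_alpha | | ]; [|by left|by right].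
  by have := height_lt_sum xy y_pos; rewrite x_alpha ltxx.
have [-> // | gl] := hookP g d g_pos d_pos gd.
have [b ba bg] := leg_partner gl; rewrite is_sumC in gd.
by rewrite (is_sum_inj gd bg) ba orbT.
Qed.

Lemma arm_notin_kpat b : b \in a -> b \notin k.
Proof.
move=> ba; have [g gl bg] := arm_partner ba; apply: contra alpha_notin_kpat => bk.
exact: normal_pattern_sum kpat_normal bk (leg_pos gl) bg.
Qed.

Definition lower_arm A : Prop :=
  A \subset a /\ forall b b', b \in A -> b' \in a -> b' \notin A -> ht b <= ht b'.

Definition partners A : {set rootT Y} := [set g in l | [exists b in A, is_sum b g alpha]].

Definition step_ker A : {set rootT Y} := k :|: partners A.

Lemma partnersP A g : reflect (exists b, [/\ b \in A, g \in l & is_sum b g alpha]) (g \in partners A).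
Proof.
rewrite inE; apply: (iffP andP) => [[gl /exists_inP[b bA bg]] | [b [bA gl bg]]].
  by exists b.
by split=> //; apply/exists_inP; exists b.
Qed.

Lemma partners_arm : partners a = l.
Proof.
apply/setP=> g; apply/partnersP/idP => [[b []] // | gl].
by have [b ba bg] := leg_partner gl; exists b.
Qed.

Lemma source_pos A : source A \subset pos. Proof. exact: subsetDl. Qed.

Section LowerArm.

Variable A : {set rootT Y}.
Hypothesis lowA : lower_arm A.

(* The summands of e are lower than e: if they avoid A then they avoid the arm,
   whose complement is closed. *)
Lemma sum_notin_lower g d e :
    g \in pos -> d \in pos -> is_sum g d e -> e \in a ->
    (forall b, b \in a -> b \notin A -> ht e <= ht b) ->
  (g \in A) || (d \in A).
Proof.
move=> g_pos d_pos gde ea low_e; have [_ closed_s _ _] := good.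
apply: contraLR ea => /norP[gA dA].
have lt_ge := height_lt_sum gde d_pos.
have lt_de : ht d < ht e by apply: height_lt_sum g_pos; rewrite is_sumC.
have g_s : g \in source a.
  by rewrite inE g_pos andbT; apply: contraL lt_ge => ga; rewrite -leNgt low_e.
have d_s : d \in source a.
  by rewrite inE d_pos andbT; apply: contraL lt_de => da; rewrite -leNgt low_e.
by have := closed_pattern_sum closed_s g_s d_s gde; rewrite inE => /andP[].
Qed.

Lemma source_closed : closed_pattern (source A).
Proof.
have [/subsetP sAa low] := lowA.
apply/andP; split; first exact: source_pos.
apply/forall_inP=> g gs; apply/forall_inP=> d ds; apply/forall_inP=> e e_pos.
move: gs ds; rewrite !in_setD => /andP[gA g_pos] /andP[dA d_pos].
apply/implyP=> gde; rewrite e_pos andbT; apply: contraL isT => eA.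
have := sum_notin_lower g_pos d_pos gde (sAa e eA) (fun b => low e b eA).
by rewrite (negPf gA) (negPf dA).
Qed.

Lemma step_ker_normal : normal_pattern (step_ker A) (source A).
Proof.
have [/subsetP sAa low] := lowA; have [_ _ _ nT] := good.
apply: normal_patternI; first exact: source_closed.
  apply/subsetP=> g /setUP[gk | /partnersP[b [bA gl bg]]]; rewrite in_setD.
    rewrite (subsetP kpat_pos) // andbT.
    by apply: contraL gk => gA; apply: arm_notin_kpat; apply: sAa.
  by rewrite (leg_pos gl) andbT; apply: contra (leg_notin_arm gl) => /sAa.
move=> g d e gN; rewrite in_setD => /andP[dA d_pos] gde.
case/setUP: gN => [gk | /partnersP[b [bA gl bg]]].
  by apply/setUP; left; apply: normal_pattern_sum kpat_normal gk d_pos gde.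
have e_pos := posroots_sum gde (leg_pos gl) d_pos.
have e_alpha : e != alpha.
  apply: contra dA => /eqP e_a; rewrite e_a is_sumC in gde.
  by rewrite (is_sum_inj gde bg).
have ht_b := height_sum bg; have ht_e := height_sum gde.
have [da | da] := boolP (d \in a).
  have le_bd := low b d bA da dA.
  by apply/setUP; left; apply: kpat_high => //; rewrite ht_b ht_e addrC lerD2l.
have d_s : d \in source a by rewrite in_setD da d_pos.
have gT : g \in Tker alpha l by rewrite !inE gl orbT.
have := normal_pattern_sum nT gT d_s gde.
rewrite in_setU1 (negPf e_alpha) => /setUP[el | ek]; last by apply/setUP; left.
apply/setUP; right; have [b' b'a b'e] := leg_partner el.
apply/partnersP; exists b'; split=> //; apply: contraT => b'A.
have ht_bd : ht b = ht b' + ht d.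
  apply: (addIr (ht g)); rewrite -ht_b (height_sum b'e) ht_e -addrA.
  by rewrite [ht d + _]addrC.
by have := low b b' bA b'a b'A; rewrite ht_bd gerDl leNgt height_posroot.
Qed.

End LowerArm.
End Arms.

(** * Reduction along an arm *)

Section Reduction.

Variable Y : exc_type.
Implicit Types (b g d e f : rootT Y) (S M A B : {set rootT Y}).
Local Notation ht g := (height (val g)).
Local Notation pos := (posroots Y).

Variable N : rootT Y -> rootT Y -> int.
Hypothesis hN : chevalley_constants N.
Variable F : finFieldType.
Hypothesis Fgood : forall m, (0 < m <= max_bond Y)%N -> m%:R != 0 :> F.
Implicit Types t u : F.
Local Notation xelt := (@xelt Y N F).
Local Notation P := (Pgrp N F).

Variable alpha : rootT Y.
Hypothesis alpha_pos : alpha \in pos.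
Local Notation k := (kpat alpha).
Variables a l : {set rootT Y}.
Hypothesis good : good_arm alpha a l.

Lemma alpha_source A : A \subset a -> alpha \in source A.
Proof.
move=> sAa; rewrite in_setD alpha_pos andbT.
by apply: contra (alpha_notin_arm good) => /(subsetP sAa).
Qed.

Lemma step_ker_k A : k \subset step_ker alpha l A. Proof. exact: subsetUl. Qed.

(** The further factors of the commutator belong to roots obtained from [alpha] by adding positive
    roots, and these lie in k(alpha). *)
Lemma comm_pairing b g : b \in a -> g \in l -> is_sum b g alpha ->
  exists2 c : F, c != 0 & forall (M : {group {perm lieF Y F}}) t u,
    P k \subset M -> P [set alpha] \subset 'N(M) ->
    [~ xelt g u, xelt b t] \in (xelt alpha (c * t * u)%R *: M)%g.
Proof.
move=> ba gl bg; have b_pos := arm_pos good ba; have g_pos := leg_pos good gl.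
have [c c0 comm_c] := comm_root hN Fgood b_pos g_pos bg.
exists c => // M t u skM nMZ.
have abs : absorbs b g k.
  move=> e h x be; have -> : e = alpha by apply: is_sum_uniq be bg.
  move=> hk hx; have x_k y : y \in pos -> is_sum h y x -> x \in k.
    move=> y_pos hy; case/setU1P: hk => [h_alpha | hk].
      by apply: kpat_above y_pos _; rewrite // -h_alpha.
    by apply: normal_pattern_sum (kpat_normal alpha) hk y_pos hy.
  case: hx => [bhx | [ghx | [h' /setU1P[-> | h'k] hh']]].
  - by apply: x_k b_pos _; rewrite is_sumC.
  - by apply: x_k g_pos _; rewrite is_sumC.
  - exact: x_k alpha_pos hh'.
  by apply: x_k hh'; apply: (subsetP (kpat_pos alpha)).
have [r [r' [rk r'k ->]]] := comm_c k t u (kpat_pos alpha) abs.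
have zZ : xelt alpha (c * t * u) \in P [set alpha] by apply/Pgrp1P=> //; eexists.
have eq_conj z : (z^-1 * (r * z * r') = r ^ z * r')%g by rewrite conjgE !mulgA.
rewrite mem_lcoset eq_conj groupM //; last exact: (subsetP skM).
by rewrite memJ_norm; [apply: (subsetP skM) | apply: (subsetP nMZ)].
Qed.

Lemma in_source A g : (g \in source A) = (g \notin A) && (g \in pos).
Proof. exact: in_setD. Qed.

Section Step.

Variables (A : {set rootT Y}) (b : rootT Y).
Hypotheses (lowA : lower_arm a A) (bA : b \in A).
Hypothesis b_max : forall b', b' \in A -> ht b' <= ht b.
Local Notation A' := (A :\ b).

Lemma lower_arm_remove : lower_arm a A'.
Proof.
have [sAa low] := lowA; split; first exact: subset_trans (subD1set _ _) sAa.
move=> b1 b2 /setD1P[_ b1A] b2a; rewrite in_setD1 negb_and negbK.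
by case/orP=> [/eqP-> | b2A]; [apply: b_max | apply: low].
Qed.

Let sAa : A \subset a. Proof. by case: lowA. Qed.
Let ba : b \in a. Proof. exact: (subsetP sAa). Qed.

Let source_remove : source A' = b |: source A.
Proof.
apply/setP=> g; rewrite in_setU1 !in_source in_setD1.
by case: eqP => // ->; rewrite (arm_pos good ba).
Qed.

(** The reason for removing the highest root: if g + d were in [A], no root of the arm outside [A']
    would be lower than g + d, so the closedness of the source of the full arm would force g or d
    into [A']. *)
Let source_step_normal : normal_pattern (source A) (source A').
Proof.
have lowA' := lower_arm_remove; have [_ low] := lowA.
apply: normal_patternI; first exact: (source_closed good lowA').
  by apply: setDS; apply: subD1set.
move=> g d e; rewrite !in_source => /andP[gA g_pos] /andP[dA d_pos] gde.
rewrite (posroots_sum gde g_pos d_pos) andbT; apply/negP=> eA.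
have := sum_notin_lower good (A := A') g_pos d_pos gde (subsetP sAa _ eA).
rewrite (negPf dA) orbF in_setD1 (negPf gA) andbF => contr.
suff: false by []. apply: contr => b1 b1a.
rewrite in_setD1 negb_and negbK => /orP[/eqP-> | b1A]; first exact: b_max.
exact: low.
Qed.

Theorem step_bij :
  bijection_on (irr_over (P (source A)) (P (step_ker alpha l A)) (P [set alpha]))
               (irr_over (P (source A')) (P (step_ker alpha l A')) (P [set alpha]))
               'Ind[P (source A')].
Proof.
have lowA' := lower_arm_remove; have [_ low] := lowA.
have sA'a : A' \subset a by case: lowA'.
have [g gl bg] := arm_partner good ba.
have g_pos := leg_pos good gl; have b_pos := arm_pos good ba.
have step_kerE : step_ker alpha l A = g |: step_ker alpha l A'.
  rewrite /step_ker setUCA; congr (_ :|: _); apply/setP=> h; rewrite in_setU1.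
  apply/partnersP/orP => [[b1 [b1A hl b1h]] | [/eqP-> | /partnersP[b1 [b1A hl b1h]]]].
  - have [b1b | b1b] := eqVneq b1 b; [left | right].
      by rewrite is_sumC b1b in b1h; rewrite is_sumC in bg; rewrite (is_sum_inj b1h bg).
    by apply/partnersP; exists b1; rewrite in_setD1 b1b.
  - by exists b.
  by exists b1; split=> //; case/setD1P: b1A.
have nHG : P (source A) <| P (source A') := Pgrp_normal hN Fgood source_step_normal.
have nM := step_ker_normal good lowA'.
have nMG := Pgrp_normal hN Fgood nM; have [sMG nGM] := andP nMG.
have nY := step_ker_normal good lowA.
have nYH := Pgrp_normal hN Fgood nY.
have skM : P k \subset P (step_ker alpha l A') by apply/PgrpS/step_ker_k.
have aS' := alpha_source sA'a; have aS := alpha_source sAa.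
have sZH : P [set alpha] \subset P (source A) by rewrite PgrpS ?sub1set.
have sZG : P [set alpha] \subset P (source A') by rewrite PgrpS ?sub1set.
have bS' : b \in source A' by rewrite source_remove setU11.
have gS : g \in source A.
  by rewrite in_source g_pos andbT; apply: contra (leg_notin_arm good gl); apply: (subsetP sAa).
have gS' : g \in source A' by rewrite source_remove in_setU1 gS orbT.
have nMZ : P [set alpha] \subset 'N(P (step_ker alpha l A')) by apply: subset_trans nGM.
have [c c0 pair_c] := comm_pairing ba gl bg.
have pair t u : [~ xelt g u, xelt b t] \in (xelt alpha (c * t * u)%R *: P (step_ker alpha l A'))%g.
  exact: pair_c.
have cZG : [~: P [set alpha], P (source A')] \subset P (step_ker alpha l A').
  apply: (Pgrp_comm_sub hN Fgood nM) => //; first by rewrite sub1set.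
  move=> x d e /set1P-> dS xde; apply/setUP; left; apply: (kpat_above alpha_pos _ xde).
  exact: (subsetP (source_pos _)) dS.
(* x_g is central in the smaller group modulo the smaller kernel: g + d stays in the larger kernel
   pattern and differs from g by its height. *)
have cYH : [~: P [set g], P (source A)] \subset P (step_ker alpha l A').
  apply: (Pgrp_comm_sub hN Fgood nM) => //; rewrite ?sub1set //.
    by rewrite source_remove subsetUr.
  move=> x d e /set1P-> dS gde; have gN : g \in step_ker alpha l A by rewrite step_kerE setU11.
  have := normal_pattern_sum nY gN dS gde; rewrite step_kerE => /setU1P[eg | //].
  have d_pos : d \in pos := subsetP (source_pos _) _ dS.
  by have := height_lt_sum gde d_pos; rewrite eg ltxx.
apply: Ind_irr_over_bij => //.
- by apply: PgrpS; rewrite step_kerE subsetUr.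
- move=> x z; rewrite in_setD => /andP[xH xG] /(Pgrp1P hN _ alpha_pos)[w ->].
  have nHb : P [set b] \subset 'N(P (source A)).
    by apply: subset_trans (normal_norm nHG); rewrite PgrpS ?sub1set.
  move: xG xH; rewrite source_remove PgrpU1 // => /mulsgP[h _ hH /(Pgrp1P hN _ b_pos)[t ->] ->].
  have [-> | t0 _] := eqVneq t 0; first by rewrite xelt0 // mulg1 hH.
  (* The commutator of x_g(u) with h x_b(t) agrees with that with x_b(t) modulo the kernel, by
     [cYH]; it remains to solve c t u = w. *)
  pose u := w / (c * t); have def_w : c * t * u = w by rewrite mulrCA mulfV ?mulr1 // mulf_neq0.
  exists (xelt g u); first by apply: mem_Pgrp; rewrite // step_kerE setU11.
  rewrite commgMJ mem_lcoset mulgA groupM //; first by rewrite -mem_lcoset -def_w.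
  rewrite memJ_norm ?(subsetP nGM) ?mem_Pgrp // (subsetP cYH) // mem_commg //.
  by rewrite mem_Pgrp ?set11.
move=> y z; rewrite in_setD => /andP[yM yY] /(Pgrp1P hN _ alpha_pos)[w ->].
have nMg : P [set g] \subset 'N(P (step_ker alpha l A')).
  by apply: subset_trans nGM; rewrite PgrpS ?sub1set.
move: yY yM; rewrite step_kerE PgrpU1 // => /mulsgP[m _ mM /(Pgrp1P hN _ g_pos)[u ->] ->].
have [-> | u0 _] := eqVneq u 0; first by rewrite xelt0 // mulg1 mM.
pose t := w / (c * u); have def_w : c * t * u = w.
  by rewrite mulrAC mulrC /t mulfVK // mulf_neq0.
exists (xelt b t); first exact: mem_Pgrp.
have bN : xelt b t \in 'N(P (step_ker alpha l A')) by rewrite (subsetP nGM) ?mem_Pgrp.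
have gN : xelt g u \in 'N(P (step_ker alpha l A')) by rewrite (subsetP nMg) ?mem_Pgrp ?set11.
have zN : xelt alpha w \in 'N(P (step_ker alpha l A')).
  by rewrite (subsetP nMZ) ?mem_Pgrp ?set11.
rewrite commMgJ mem_lcoset.
have eq_conj (x1 x2 x3 : {perm lieF Y F}) : (x1^-1 * (x2 * x3) = x2 ^ x1 * (x1^-1 * x3))%g.
  by rewrite conjgE !mulgA mulgK.
rewrite eq_conj groupM //; last by rewrite -mem_lcoset -{1}def_w.
by rewrite (memJ_norm _ zN) (memJ_norm _ gN) commgEl groupM ?groupV // (memJ_norm _ bN).
Qed.

End Step.

Theorem chain_bij A : lower_arm a A ->
  bijection_on (irr_over (P (source A)) (P (step_ker alpha l A)) (P [set alpha]))
               (irr_over (P pos) (P k) (P [set alpha])) 'Ind[P pos].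
Proof.
have [m] := ubnP #|A|; elim: m A => // m IHm A; rewrite ltnS => le_A lowA.
have [A0 | [b0 b0A]] := set_0Vmem A.
  have -> : P (source A) = P pos by rewrite A0 /source setD0.
  have -> : step_ker alpha l A = k.
    apply/setUidPl/subsetP=> g /partnersP[b []]; by rewrite A0 in_set0.
  by split=> [chi | chi psi _ _ | chi chiO]; rewrite ?cfInd_id //; exists chi;
    rewrite ?cfInd_id.
have [b bA b_max] : exists2 b, b \in A & forall b', b' \in A -> ht b' <= ht b.
  have pA x : x \in A -> 0 <= ht x.
    move=> xA; apply: ltW; apply: height_posroot; apply: (arm_pos good).
    by case: lowA => /subsetP sAa _; apply: sAa.
  (* The maximum is taken over naturals; the heights in [A] are positive, so absolute values do not
     change the order. *)
  case: (arg_maxnP (P := mem A) (fun x => `|ht x|%N) b0A) => b bA b_max.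
  exists b => // b' b'A; have /= := b_max b' b'A.
  by rewrite -lez_nat !gez0_abs ?pA.
have IH := IHm (A :\ b) _ (lower_arm_remove lowA b_max).
have step := step_bij lowA bA b_max.
apply: bijection_on_eq (bijection_on_comp step (IH _)) => [chi | // | ].
  by rewrite /= cfIndInd ?PgrpS ?source_pos // setDS // subD1set.
by move: le_A; rewrite (cardsD1 b) bA.
Qed.

Lemma chain_bij_full :
  bijection_on (irr_over (P (source a)) (P (l :|: k)) (P [set alpha]))
               (irr_over (P pos) (P k) (P [set alpha])) 'Ind[P pos].
Proof.
have lowa : lower_arm a a by split=> // b b' _ b'a; rewrite b'a.
by have := chain_bij lowa; rewrite /step_ker (partners_arm good) setUC.
Qed.

End Reduction.

(** * Characters with a single root *)

Section SingleRoot.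

Variable Y : exc_type.
Implicit Types (b g d e f : rootT Y) (S M A B : {set rootT Y}).
Local Notation ht g := (height (val g)).
Local Notation pos := (posroots Y).

Variable N : rootT Y -> rootT Y -> int.
Hypothesis hN : chevalley_constants N.
Variable F : finFieldType.
Hypothesis Fgood : forall m, (0 < m <= max_bond Y)%N -> m%:R != 0 :> F.
Implicit Types t u : F.
Local Notation xelt := (@xelt Y N F).
Local Notation P := (Pgrp N F).

Definition higher (m : int) : {set rootT Y} := [set f in pos | m < ht f].

Lemma in_higher m f : (f \in higher m) = (f \in pos) && (m < ht f).
Proof. exact: in_set. Qed.

Lemma higher_normal m : normal_pattern (higher m) pos.
Proof.
apply: normal_patternI; first exact: closed_posroots.
  by apply/subsetP=> f; rewrite in_higher => /andP[].
move=> g d e; rewrite !in_higher => /andP[g_pos lt_mg] d_pos gde.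
by rewrite (posroots_sum gde g_pos d_pos) (lt_trans lt_mg) ?(height_lt_sum gde).
Qed.

Lemma rset_in (chi : 'CF(P pos)) g : g \in pos ->
  (g \in rset chi) = (P [set g] \subset 'Z(chi)%CF) && ~~ (P [set g] \subset cfker chi).
Proof. by move=> g_pos; rewrite !Pgrp1 // [LHS]in_set g_pos. Qed.

Lemma P1_sub g : g \in pos -> P [set g] \subset P pos.
Proof. by move=> g_pos; rewrite PgrpS ?sub1set. Qed.

Lemma center_modulo (chi : 'CF(P pos)) M g :
    chi \in irr (P pos) -> g \in pos -> normal_pattern M pos -> P M \subset cfker chi ->
    (forall d e, d \in pos -> is_sum g d e -> e \in M) ->
  P [set g] \subset 'Z(chi)%CF.
Proof.
move=> irr_chi g_pos nM kM gM; rewrite sub_cfcenter_irr ?P1_sub //.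
apply: subset_trans kM; apply: (Pgrp_comm_sub hN Fgood nM) => //.
- by rewrite sub1set.
- by move=> x d e /set1P->; apply: gM.
exact: normal_norm (Pgrp_normal hN Fgood nM).
Qed.

Variable alpha : rootT Y.
Hypothesis alpha_pos : alpha \in pos.
Local Notation k := (kpat alpha).

(** Otherwise take e of greatest height among the roots of k(alpha) with X_e outside the kernel.
    Modulo the higher roots of k(alpha), which act trivially, X_e is central; so e belongs to
    [rset chi] and equals [alpha], which is not in k(alpha). *)
Lemma rset_single_ker (chi : 'CF(P pos)) :
  chi \in irr (P pos) -> rset chi = [set alpha] -> P k \subset cfker chi.
Proof.
move=> irr_chi rs; pose bad := [set e in k | ~~ (P [set e] \subset cfker chi)].
have k_pos := subsetP (kpat_pos alpha).
have in_bad e : (e \in bad) = (e \in k) && ~~ (P [set e] \subset cfker chi) by exact: in_set.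
have [bad0 | [e0 e0bad]] := set_0Vmem bad.
  apply/(sub_PgrpP hN) => [|g t gk]; first exact: kpat_pos.
  have: g \notin bad by rewrite bad0 in_set0.
  rewrite in_bad gk negbK => /subsetP; apply.
  by apply/(Pgrp1P hN _ (k_pos g gk)); exists t.
have ht_ge0 x : x \in k -> 0 <= ht x by move/k_pos/height_posroot/ltW.
case: (arg_maxnP (P := mem bad) (fun x => `|ht x|%N) e0bad) => e /= e_bad e_max.
move: (e_bad); rewrite in_bad => /andP[ek nker]; have e_pos := k_pos e ek.
pose M := k :&: higher (ht e).
have nM : normal_pattern M pos.
  apply: normal_patternI; first exact: closed_posroots.
    by apply/subsetP=> f /setIP[/k_pos].
  move=> g d f /setIP[gk gh] d_pos gdf; rewrite in_setI.
  rewrite (normal_pattern_sum (kpat_normal alpha) gk d_pos gdf).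
  exact: normal_pattern_sum (higher_normal _) gh d_pos gdf.
have kM : P M \subset cfker chi.
  apply/(sub_PgrpP hN) => [|g t]; first exact: normal_pattern_sub nM.
  case/setIP=> gk; rewrite in_higher => /andP[g_pos lt_eg].
  have: g \notin bad.
    apply: contraL lt_eg => /e_max; rewrite -lez_nat !gez0_abs ?ht_ge0 //.
    by rewrite -leNgt.
  rewrite in_bad gk negbK => /subsetP; apply.
  by apply/(Pgrp1P hN _ g_pos); exists t.
have eZ : P [set e] \subset 'Z(chi)%CF.
  apply: center_modulo nM kM _ => // d f d_pos edf; rewrite in_setI in_higher.
  rewrite (normal_pattern_sum (kpat_normal alpha) ek d_pos edf).
  by rewrite (posroots_sum edf e_pos d_pos) (height_lt_sum edf d_pos).
have: e \in rset chi by rewrite rset_in // eZ nker.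
by rewrite rs in_set1 => /eqP e_alpha; move: ek; rewrite e_alpha (negPf (alpha_notin_kpat _)).
Qed.

(* x_g(u) s is central modulo ker chi, and its commutator with x_d(1) is x_e(c u)
   up to factors in higher roots. *)
Lemma leading_root_ker (chi : 'CF(P pos)) g d e :
    g \in pos -> d \in pos -> is_sum g d e ->
    (forall u, exists2 s, s \in P (higher (ht g)) &
       forall x, x \in P pos -> [~ (xelt g u * s)%g, x] \in cfker chi) ->
  forall t, exists2 r, r \in P (higher (ht e)) & (xelt e t * r)%g \in cfker chi.
Proof.
move=> g_pos d_pos gde lead t; have e_pos := posroots_sum gde g_pos d_pos.
have dge : is_sum d g e by rewrite is_sumC.
have [c c0 comm_c] := comm_root hN Fgood d_pos g_pos dge.
have [s sg ker_s] := lead (t / c).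
pose H := P (higher (ht e)).
have nH := Pgrp_normal hN Fgood (higher_normal (ht e)).
have nHU : P pos \subset 'N(H) := normal_norm nH.
have sHpos : higher (ht e) \subset pos := normal_pattern_sub (higher_normal _).
have abs : absorbs d g (higher (ht e)).
  move=> e' h x dge'; have -> : e' = e by apply: is_sum_uniq dge' dge.
  move=> hM hx; have le_eh : ht e <= ht h.
    by case/setU1P: hM => [-> // | ]; rewrite in_higher => /andP[_ /ltW].
  have h_pos : h \in pos by case/setU1P: hM => [-> // | /(subsetP sHpos)].
  have higher_sum y : y \in pos -> is_sum h y x -> x \in higher (ht e).
    move=> y_pos hy; rewrite in_higher (posroots_sum hy h_pos y_pos).
    exact: le_lt_trans le_eh (height_lt_sum hy y_pos).
  case: hx => [dhx | [ghx | [h' h'M hh']]].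
  - by apply: higher_sum d_pos _; rewrite is_sumC.
  - by apply: higher_sum g_pos _; rewrite is_sumC.
  apply: higher_sum hh'; by case/setU1P: h'M => [-> // | /(subsetP sHpos)].
have [r [r' [rH r'H comm_gd]]] := comm_c _ 1 (t / c) sHpos abs.
have xU h w : h \in pos -> xelt h w \in P pos by move=> h_pos; apply: mem_Pgrp.
have higher_U m : P (higher m) \subset P pos.
  exact: PgrpS (normal_pattern_sub (higher_normal m)).
have sU := subsetP (higher_U _) s sg.
have coset_conj x y h : x \in P pos -> y \in 'N(H) -> h \in H -> [~ x, y] \in H ->
    ((x * h) ^ y)%g \in (x *: H)%g.
  move=> xP yN hH cxy; rewrite mem_lcoset conjMg mulgA -commgEl groupM //.
  by rewrite memJ_norm.
have xe_comm y : y \in P pos -> [~ xelt e t, y] \in H.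
  have: [~: P [set e], P pos] \subset H.
    apply: (Pgrp_comm_sub hN Fgood (higher_normal (ht e))) => //; first by rewrite sub1set.
    move=> x h f /set1P-> h_pos ehf; rewrite in_higher (posroots_sum ehf e_pos h_pos).
    exact: height_lt_sum ehf h_pos.
  move=> /subsetP cH yU; apply/cH/mem_commg => //; apply/(Pgrp1P hN _ e_pos); by exists t.
have s_comm : [~ s, xelt d 1] \in H.
  have: [~: P (higher (ht g)), P [set d]] \subset H.
    apply: (Pgrp_comm_sub hN Fgood (higher_normal (ht e))) => //.
    - exact: normal_pattern_sub (higher_normal _).
    - by rewrite sub1set.
    move=> h x f; rewrite in_higher => /andP[h_pos lt_gh] /set1P-> hdf.
    rewrite in_higher (posroots_sum hdf h_pos d_pos) (height_sum hdf) (height_sum gde).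
    by rewrite ltrD2r.
  move=> /subsetP cH; apply/cH/mem_commg => //; apply/(Pgrp1P hN _ d_pos); by exists 1.
suff: [~ (xelt g (t / c)%R * s)%g, xelt d 1] \in (xelt e t *: H)%g.
  rewrite mem_lcoset => rH0; exists ((xelt e t)^-1 * [~ xelt g (t / c)%R * s, xelt d 1%R])%g;
    first exact: rH0.
  by rewrite mulVKg; apply: ker_s; apply: xU.
have ct : c * 1 * (t / c) = t by rewrite mulr1 mulrC mulfVK.
have gd_coset : [~ xelt g (t / c), xelt d 1] \in (xelt e t *: H)%g.
  rewrite comm_gd ct mem_lcoset.
  have -> : ((xelt e t)^-1 * (r * xelt e t * r') = r ^ xelt e t * r')%g by rewrite conjgE !mulgA.
  by rewrite groupM // memJ_norm // (subsetP nHU) // xU.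
move: gd_coset => /lcosetP[h hH gdE].
rewrite commMgJ gdE mem_lcoset mulgA groupM // -mem_lcoset.
by apply: coset_conj => //; [apply: xU | apply: (subsetP nHU) | apply: xe_comm].
Qed.

(** From right to left, suppose that g other than [alpha] lies in [rset chi]. The set [M] of g and
    of all leading roots of kernel elements is a normal pattern. If it avoided [alpha], it would be
    inside k(alpha), and X_g in the kernel. So [alpha] is a leading root, and since all higher roots
    lie in k(alpha), X_alpha is in the kernel, a contradiction. *)
Lemma irr_single_over (chi : 'CF(P pos)) :
  irr_single N F alpha chi = irr_over (P pos) (P k) (P [set alpha]) chi.
Proof.
apply/andP/and3P=> [[irr_chi /eqP rs] | [irr_chi kk nka]].
  have : alpha \in rset chi by rewrite rs set11.
  rewrite rset_in // => /andP[_ nka].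
  by split; [exact: irr_chi | exact: (rset_single_ker irr_chi rs) | exact: nka].
split=> //; apply/eqP/setP=> g; rewrite in_set1.
have [-> | g_alpha] := eqVneq g alpha.
  rewrite rset_in // nka andbT; apply: (center_modulo irr_chi alpha_pos (kpat_normal alpha) kk).
  exact: kpat_above.
apply/negP=> grs; have g_pos : g \in pos by move: grs; rewrite [_ \in rset _]in_set => /andP[].
move: grs; rewrite rset_in // => /andP[gZ ngk].
(* Every x_e(t) is, up to higher roots, an element of the kernel of [chi]. *)
pose full e := [forall t, [exists r, (r \in P (higher (ht e))) && ((xelt e t * r)%g \in cfker chi)]].
have fullP e : reflect (forall t, exists2 r, r \in P (higher (ht e)) & (xelt e t * r)%g \in cfker chi)
    (full e).
  apply: (iffP forallP) => fe t; first by have /existsP[r /andP[]] := fe t; exists r.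
  by have [r rH re] := fe t; apply/existsP; exists r; rewrite rH.
pose M := g |: [set e in pos | full e].
have in_M e : (e \in M) = (e == g) || (e \in pos) && full e by rewrite in_setU1 [in LHS]in_set.
have [sKU nKU] := andP (cfker_normal chi).
have cgZ : [~: P [set g], P pos] \subset cfker chi by rewrite -sub_cfcenter_irr ?P1_sub.
have nM : normal_pattern M pos.
  apply: normal_patternI; first exact: closed_posroots.
    by apply/subsetP=> e; rewrite in_M => /orP[/eqP-> | /andP[]].
  move=> f d e; rewrite !in_M => fM d_pos fde.
  have f_pos : f \in pos by case/orP: fM => [/eqP-> | /andP[]].
  rewrite (posroots_sum fde f_pos d_pos) /= orbC; apply/orP; left; apply/fullP.
  apply: leading_root_ker f_pos d_pos fde _ => u.
  case/orP: fM => [/eqP-> | /andP[_ /fullP/(_ u)[s sf ker_s]]].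
    exists 1%g; rewrite ?group1 // mulg1 => x xU.
    by apply: (subsetP cgZ); rewrite mem_commg //; apply/(Pgrp1P hN _ g_pos); exists u.
  exists s => // x xU; rewrite commgEl groupM ?groupV //.
  by rewrite memJ_norm // (subsetP nKU).
have gk : g \notin k.
  apply: contra ngk => gk; apply: subset_trans kk; by rewrite PgrpS ?sub1set.
have : alpha \in M.
  by apply: contraR gk => aM; apply: (subsetP (kpat_max nM aM)); rewrite setU11.
rewrite in_M eq_sym (negPf g_alpha) alpha_pos /= => /fullP full_a.
case/negP: nka; apply/(sub_PgrpP hN) => [|x t /set1P->]; first by rewrite sub1set.
have [r rH ra] := full_a t.
have rk : r \in cfker chi.
  apply: (subsetP kk); apply: subsetP rH; apply: PgrpS; apply/subsetP=> f.
  rewrite in_higher => /andP[f_pos lt_af]; apply: kpat_high => //; first exact: ltW.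
  by apply: contraTneq lt_af => ->; rewrite ltxx.
by rewrite -(mulgK r (xelt alpha t)) groupM ?groupV.
Qed.

End SingleRoot.

(** * The correspondence for a good arm *)

Section GoodArm.

Variable Y : exc_type.
Local Notation pos := (posroots Y).
Variable N : rootT Y -> rootT Y -> int.
Hypothesis hN : chevalley_constants N.
Variable F : finFieldType.
Hypothesis Fgood : forall m, (0 < m <= max_bond Y)%N -> m%:R != 0 :> F.
Local Notation P := (Pgrp N F).
Variables (alpha : rootT Y) (a l : {set rootT Y}).
Hypotheses (alpha_pos : alpha \in pos) (good : good_arm alpha a l).
Local Notation k := (kpat alpha).

(** Whenever [alpha] is a sum of two positive roots one of them is in the arm, so no sum within the
    source equals [alpha]. *)
Lemma source_minus_normal : normal_pattern (source a :\ alpha) (source a).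
Proof.
have [_ cs _ _] := good.
apply: normal_patternI => // [|g d e]; first exact: subD1set.
rewrite in_setD1 => /andP[_ gs] ds gde;
  rewrite in_setD1 (closed_pattern_sum cs gs ds gde) andbT.
move: gs ds; rewrite !in_source => /andP[/negPf ga g_pos] /andP[/negPf da d_pos].
apply: contraFneq ga => e_alpha; rewrite e_alpha in gde.
by have := sum_alpha_arm good g_pos d_pos gde; rewrite da orbF.
Qed.

Lemma source_sdprod : (P (source a :\ alpha) ><| Xalpha N F alpha = Salpha N F a)%g.
Proof.
have nB := source_minus_normal; have nBG := Pgrp_normal hN Fgood nB.
have as_ : alpha \in source a by rewrite in_source (alpha_notin_arm good).
have nX : P [set alpha] \subset 'N(P (source a :\ alpha)).
  by apply: subset_trans (normal_norm nBG); rewrite PgrpS ?sub1set.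
have cB : closed_pattern (source a :\ alpha).
  apply/andP; split; first by apply: subset_trans (subD1set _ _) (source_pos _).
  apply/forall_inP=> g gB; apply/forall_inP=> d dB; apply/forall_inP=> e _; apply/implyP.
  exact: normal_pattern_sum nB gB (subsetP (subD1set _ _) _ dB).
rewrite /Xalpha /Salpha sdprodE //; first by rewrite -PgrpU1 // setD1K.
apply/trivgP/subsetP=> x /setIP[xB /(Pgrp1P hN _ alpha_pos)[t def_x]].
move: xB; rewrite def_x => xB; rewrite (xelt_notin_Pgrp hN Fgood cB alpha_pos _ xB) ?setD11 //.
by rewrite xelt0 ?set11.
Qed.

Lemma Pgrp1_abelian : abelian (P [set alpha]).
Proof.
apply/centsP=> _ /(Pgrp1P hN _ alpha_pos)[t ->] _ /(Pgrp1P hN _ alpha_pos)[u ->].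
by rewrite /commute -!xeltD // addrC.
Qed.

Lemma Psi_bij : bijection_on (irr_pairs N F alpha a l) (irr_single N F alpha)
                             (Psi N F alpha a l source_sdprod).
Proof.
have [_ _ _ nT] := good; have nTG := Pgrp_normal hN Fgood nT.
have sTs := subsetP (normal_pattern_sub nT).
have lowa : lower_arm a a by split=> // b b' _ b'a; rewrite b'a.
have nL : normal_pattern (l :|: k) (source a).
  by have := step_ker_normal good lowa; rewrite /step_ker (partners_arm good) setUC.
have as_ : alpha \in source a by rewrite in_source (alpha_notin_arm good).
have infl : bijection_on (irr_pairs N F alpha a l)
    (irr_over (P (source a)) (P (l :|: k)) (P [set alpha])) (infl_mul source_sdprod).
  apply: infl_mul_bij.
  - exact: nTG.
  - by apply: PgrpS; rewrite subsetUr.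
  - by apply: PgrpS; rewrite sub1set setU11.
  - by rewrite /TkerG /Tker PgrpU joingC.
  - apply: PgrpS; apply/subsetP=> g gL; rewrite in_setD1 sTs ?andbT;
    last by rewrite inE gL orbT.
    apply: contraTneq gL => ->; rewrite in_setU negb_or alpha_notin_kpat andbT.
    by have [[_ [_ ? _] _ _] _ _ _] := good.
  - exact: Pgrp1_abelian.
  apply: (Pgrp_comm_sub hN Fgood nL) => //; first by rewrite sub1set.
    move=> g d e /set1P-> ds ade; rewrite in_setU; apply/orP; right.
    exact: (kpat_above alpha_pos (subsetP (source_pos a) _ ds) ade).
  exact: normal_norm (Pgrp_normal hN Fgood nL).
have chain := chain_bij_full hN Fgood alpha_pos good.
apply: bijection_on_eq (bijection_on_comp infl chain) => // chi.
exact: esym (irr_single_over hN Fgood alpha_pos chi).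
Qed.

End GoodArm.

Theorem theorem1p3 (Y : exc_type) (p k : nat) (F : finFieldType)
    (hp : prime p) (hq : #|F| = (p ^ k)%N)
    (hG2 : Y = TypeG2 -> (3 < p)%N) (hF4 : Y = TypeF4 -> (2 < p)%N)
    (N : rootT Y -> rootT Y -> int) (hN : chevalley_constants N)
    (alpha : rootT Y) (halpha : alpha \in posroots Y)
    (harm : exists a l : {set rootT Y}, good_arm alpha a l) :
  exists a l : {set rootT Y},
    [/\ good_arm alpha a l,
        (TkerG N F alpha l <| Salpha N F a)%g &
        exists defS : (Pgrp N F (source a :\ alpha) ><| Xalpha N F alpha
                       = Salpha N F a)%g,
          bijection_on (irr_pairs N F alpha a l) (irr_single N F alpha)
                       (Psi N F alpha a l defS)].
Proof.
have Fgood m : (0 < m <= max_bond Y)%N -> m%:R != 0 :> F.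
  have bond_lt_p : (max_bond Y < p)%N.
    by case: (Y) hG2 hF4 => hG hF; rewrite /= ?prime_gt1 ?hG ?hF.
  move=> /andP[m_gt0 le_m]; have charp := card_finPcharP hq hp.
  by rewrite -(dvdn_pcharf charp) gtnNdvd // (leq_ltn_trans le_m).
have [a [l good]] := harm; exists a, l; split=> //.
  by have [_ _ _ nT] := good; apply: (Pgrp_normal hN Fgood nT).
by exists (source_sdprod hN Fgood halpha good); apply: Psi_bij.
Qed.
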